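(* Consider the model $y_i=F(x_i)+z_i$, $1\le i\le n$, with $F=\sum_{k=1}^q f_k u_k$, described in the context. Suppose we have an estimate $\hat U=(\hat u_1\ \ldots\ \hat u_q)\in\mathbb{R}^{p\times q}$ of $U=(u_1\ \ldots\ u_q)$ satisfying $$E\left\{\|\sin\Theta(\hat U,U)\|^4\right\}\le C(p/n)^2$$ and that the General Estimation Procedure is direction invariant, resulting in a bounded linear smoother $L$, $\|L\|\le C$, attaining the rate $r$. Then if $p=O(n)$ and $\max_k\|f_k\|_\infty\le B$, the corresponding estimator $\hat F=\sum_{k=1}^q\hat u_k\hat f_k$ formed from the General Estimation Procedure admits an error $$E\{R_n(\hat F)\}\lesssim q\,n^{-r}\max\left\{1,\;p\,n^{-(1-r)}\right\}.$$ Consequently, as long as $p=O(n^{1-r})$, we have $E\{R_n(\hat F)\}\lesssim q\,n^{-r}$.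
   Context: **Model.** $(x_i,y_i)$, $i=1,\dots,n$, are i.i.d. observations with $x_i$ uniform on $[0,1]^d$ and $y_i=F(x_i)+z_i\in\mathbb{R}^p$, where $z_1,\dots,z_n$ are i.i.d. $\mathcal N(0,\sigma^2I_p)$ and $E(y_i\mid x_i)=F(x_i)$. Here $F(x)=\sum_{k=1}^q f_k(x)u_k$ with $q\le p$, $u_1,\dots,u_q\in\mathbb{R}^p$ orthonormal, and $f_1,\dots,f_q$ smooth functions that are orthogonal in $L^2[0,1]^d$. **Constants.** $B$ and $C$ denote constants ($C$ may differ between occurrences), and $a\lesssim b$ means $a\le Cb$ for a constant $C$. **Norms and angles.** For a matrix, $\|\cdot\|$ is the spectral norm; for a vector it is the Euclidean norm. For a function $g$, $\|g\|_n^2=\frac1n\sum_{i=1}^n g(x_i)^2$ (for a vector of fitted values in $\mathbb{R}^n$, $\|\cdot\|_n^2=\frac1n\|\cdot\|^2$), and $\|g\|_\infty$ is the sup norm. For $p\times q$ matrices $U,V$ with orthonormal columns, if $\sigma_1\ge\dots\ge\sigma_q\ge0$ are the singular values of $U^{T}V$, then $\Theta(U,V)=\mathrm{diag}(\cos^{-1}\sigma_1,\dots,\cos^{-1}\sigma_q)$, and $\|\sin\Theta(U,V)\|$ is the spectral norm of the matrix obtained by applying $\sin$ to the diagonal entries. **Risk.** $R_n(G)=\frac1n\sum_{i=1}^n\|F(x_i)-G(x_i)\|^2$. **General Estimation Procedure.** Step 1: find an estimate $\hat U=(\hat u_1\ \ldots\ \hat u_q)$ of $U$ (with orthonormal columns).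 Step 2: for each $k=1,\dots,q$ let $\hat f_k$ be the minimizer over $g_k$ of $\frac1n\sum_{i=1}^n\{\hat u_k^{T}y_i-g_k(x_i)\}^2$, or of a penalized version $\frac1n\sum_{i=1}^n\{\hat u_k^{T}y_i-g_k(x_i)\}^2+\mathcal P_k(g_k)$, where $\mathcal P_k$ is a seminorm penalizing smoothness. The estimate is $\hat F=\sum_{k=1}^q\hat u_k\hat f_k$. **Direction invariance.** The procedure is direction invariant if, for any vectors $v_1,\dots,v_q$, minimizing $\frac1n\sum_{i=1}^n\{v_k^{T}y_i-g_k(x_i)\}^2+\mathcal P_k(g_k)$ along the directions $v_k$ results in an identical smoothing procedure applied to the data $v_k^{T}y_i$ for $k=1,\dots,q$. It results in the linear smoother $L$ (an $n\times n$ matrix) if the vector of fitted values at $x_1,\dots,x_n$ is $L$ applied to the rotated data; in particular $(\hat f_k(x_1),\dots,\hat f_k(x_n))^{T}=L(\hat u_k^{T}y_1,\dots,\hat u_k^{T}y_n)^{T}$. **Rate.** Let $Y^o_{\cdot k}=(u_k^{T}y_1,\dots,u_k^{T}y_n)^{T}$ be the oracle rotated data and $\hat f_k^o=LY^o_{\cdot k}$ the resulting estimates. $L$ attains the rate $r$ if $\max_{1\le k\le q}E\|\hat f_k^o-f_k\|_n^2\le Cn^{-r}$. *)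

(* Defs.v *)
From HB Require Import structures.
From mathcomp Require Import all_boot all_order all_algebra.
From mathcomp Require Import all_classical all_reals all_analysis.

Set Implicit Arguments.
Unset Strict Implicit.
Unset Printing Implicit Defensive.

Import Order.TTheory GRing.Theory Num.Theory.
Import numFieldNormedType.Exports.

Local Open Scope classical_set_scope.
Local Open Scope ring_scope.

(* Conventions.  Points of R^d are row vectors.  A design (x_1, ..., x_n) is an
   n x d matrix and the responses (y_1, ..., y_n) form an n x p matrix, one
   observation per row.  The directions u_k are the columns of a p x q matrix,
   so that the data (v^T y_1, ..., v^T y_n)^T rotated along v is y *m v. *)

Section Norms.
Variable R : realType.

Definition enorm n (v : 'cV[R]_n) : R := Num.sqrt (\sum_i v i 0 ^+ 2).

(* The norm that mathcomp-analysis puts on matrices is the sup norm. *)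
Definition spectral_norm m n (A : 'M[R]_(m, n)) : R :=
  sup [set enorm (A *m v) | v in [set v : 'cV[R]_n | enorm v <= 1]].

(* the square of || . ||_n, on vectors of values at the n design points *)
Definition empnorm2 n (v : 'cV[R]_n) : R := n%:R^-1 * enorm v ^+ 2.

End Norms.

Section Angles.
Variable R : realType.

Definition orthonormal_cols p q (U : 'M[R]_(p, q)) : Prop :=
  U^T *m U = 1%:M.

(* Nonincreasing nonnegative square roots of the eigenvalues of A^T A, counted
   with multiplicity. *)
Definition is_singular_values q (A : 'M[R]_q) (s : 'rV[R]_q) : Prop :=
  [/\ forall i, 0 <= s 0 i,
      forall i j : 'I_q, (i <= j)%N -> s 0 j <= s 0 i
    & char_poly (A^T *m A) = \prod_(i < q) ('X - (s 0 i ^+ 2)%:P)].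

(* Such a vector always exists, so the default value 0 plays no role. *)
Definition singular_values q (A : 'M[R]_q) : 'rV[R]_q :=
  xget 0 [set s | is_singular_values A s].

Definition principal_angles p q (U V : 'M[R]_(p, q)) : 'rV[R]_q :=
  map_mx acos (singular_values (U^T *m V)).

Definition sinTheta p q (U V : 'M[R]_(p, q)) : 'M[R]_q :=
  diag_mx (map_mx sin (principal_angles U V)).

End Angles.

Section Functions.
Variable R : realType.

Definition in_cube d (x : 'rV[R]_d) : Prop := forall j, 0 <= x 0 j <= 1.

Definition design_in_cube n d (x : 'M[R]_(n, d)) : Prop :=
  forall i, in_cube (row i x).

Fixpoint cont_diff d (s : nat) (g : 'rV[R]_d -> R) : Prop :=
  if s is s'.+1 then
    continuous g /\
    forall j : 'I_d, (forall x, derivable g x (delta_mx 0 j)) /\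
                     cont_diff s' (fun x => 'D_(delta_mx 0 j) g x)
  else continuous g.

(* Smoothness of order s on the closed cube; values outside do not matter. *)
Definition smooth_on_cube d (s : nat) (f : 'rV[R]_d -> R) : Prop :=
  exists2 g, cont_diff s g & forall x, in_cube x -> f x = g x.

(* The integral over [0,1]^d as an iterated integral (Fubini); it is only
   applied to functions that are continuous on the cube. *)
Fixpoint cube_integral d : ('rV[R]_d -> R) -> R :=
  if d is d'.+1 then fun g =>
    \int[lebesgue_measure]_(t in `[0, 1])
      cube_integral (fun v : 'rV[R]_d' => g (row_mx (t%:M : 'rV_1) v))
  else fun g => g 0.

Definition L2_orthogonal d q (f : 'I_q -> 'rV[R]_d -> R) : Prop :=
  forall k l, k != l -> cube_integral (fun x => f k x * f l x) = 0.

(* F = \sum_k f_k u_k *)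
Definition regression_fun d p q (U : 'M[R]_(p, q)) (f : 'I_q -> 'rV[R]_d -> R)
    (x : 'rV[R]_d) : 'cV[R]_p :=
  \sum_(k < q) f k x *: col k U.

Definition values n d (x : 'M[R]_(n, d)) (g : 'rV[R]_d -> R) : 'cV[R]_n :=
  \col_i g (row i x).

(* R_n(G), where F is the true regression function *)
Definition risk n d p (x : 'M[R]_(n, d)) (F G : 'rV[R]_d -> 'cV[R]_p) : R :=
  n%:R^-1 * \sum_(i < n) enorm (F (row i x) - G (row i x)) ^+ 2.

End Functions.

Notation borel T := (g_sigma_algebraType (@open T)).

Section RandomMatrices.
Context (R : realType) (disp : measure_display) (T : measurableType disp).
Variable P : probability T R.

Definition random_matrix m n (W : T -> 'M[R]_(m, n)) : Prop :=
  measurable_fun [set: T] (W : T -> borel 'M[R]_(m, n)).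

Definition independent_rows n m (W : T -> 'M[R]_(n, m)) : Prop :=
  forall A : 'I_n -> set (borel 'rV[R]_m), (forall i, measurable (A i)) ->
  P [set w | forall i, A i (row i (W w))] =
  (\prod_(i < n) P [set w | A i (row i (W w))])%E.

Definition identical_rows n m (W : T -> 'M[R]_(n, m)) : Prop :=
  forall (i j : 'I_n) (A : set (borel 'rV[R]_m)), measurable A ->
  P [set w | A (row i (W w))] = P [set w | A (row j (W w))].

(* The random vector V has law mu \x ... \x mu: the product measure is
   determined by its values on measurable rectangles. *)
Definition has_product_law m (V : T -> 'rV[R]_m)
    (mu : set (measurableTypeR R) -> \bar R) : Prop :=
  forall A : 'I_m -> set (measurableTypeR R), (forall j, measurable (A j)) ->
  P [set w | forall j, A j (V w 0 j)] = (\prod_(j < m) mu (A j))%E.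

(* E(h | V) = g(V) *)
Definition cond_expectation_is m (h : T -> R) (V : T -> 'rV[R]_m)
    (g : 'rV[R]_m -> R) : Prop :=
  P.-integrable [set: T] (EFin \o h) /\
  forall A : set (borel 'rV[R]_m), measurable A ->
  (\int[P]_(w in [set w | A (V w)]) (h w)%:E =
   \int[P]_(w in [set w | A (V w)]) (g (V w))%:E)%E.

(* Independence of the noise from the design is not assumed beyond
   E(y_i | x_i) = F(x_i). *)
Record regression_model n d p q (s : nat) (sigma : R) (U : 'M[R]_(p, q))
    (f : 'I_q -> 'rV[R]_d -> R) (X : T -> 'M[R]_(n, d))
    (Z Y : T -> 'M[R]_(n, p)) : Prop := RegressionModel {
  model_dim : (q <= p)%N;
  model_orthonormal : orthonormal_cols U;
  model_smooth : forall k, smooth_on_cube s (f k);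
  model_orthogonal : L2_orthogonal f;
  model_design_measurable : random_matrix X;
  model_noise_measurable : random_matrix Z;
  model_equation : forall w i,
    (row i (Y w))^T = regression_fun U f (row i (X w)) + (row i (Z w))^T;
  model_observations_independent :
    independent_rows (fun w => row_mx (X w) (Y w));
  model_observations_identical :
    identical_rows (fun w => row_mx (X w) (Y w));
  model_cube : forall w, design_in_cube (X w);
  model_uniform : forall i,
    has_product_law (fun w => row i (X w)) (uniform_prob (@ltr01 R));
  model_noise_independent : independent_rows Z;
  model_normal : forall i,
    has_product_law (fun w => row i (Z w)) (normal_prob 0 sigma);
  model_cond_expectation : forall i j,
    cond_expectation_is (fun w => Y w i j) (fun w => row i (X w))
      (fun x => regression_fun U f x j 0)
}.

End RandomMatrices.

Section Procedure.
Context (R : realType) (d : nat).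
Local Notation fn := ('rV[R]_d -> R).

(* Seminorms may take the value +oo off the space on which they are finite. *)
Definition seminorm (J : fn -> \bar R) : Prop :=
  [/\ forall g, (0 <= J g)%E,
      forall (c : R) g, J (fun x => c * g x) = (`|c|%:E * J g)%E
    & forall g h, (J (fun x => g x + h x)%R <= J g + J h)%E].

(* A penalty is a seminorm or, as for smoothing splines, a squared seminorm.
   The unpenalized criterion is the case of the zero seminorm. *)
Definition smoothness_penalty (pen : fn -> \bar R) : Prop :=
  exists2 J, seminorm J & pen = J \/ pen = (fun g => J g * J g)%E.

Definition criterion n (pen : fn -> \bar R) (x : 'M[R]_(n, d)) (v : 'cV[R]_n)
    (g : fn) : \bar R :=
  ((n%:R^-1 * \sum_(i < n) (v i 0 - g (row i x)) ^+ 2)%:E + pen g)%E.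

(* g minimizes the criterion over the class G of candidate functions *)
Definition is_minimizer n (G : set fn) (pen : fn -> \bar R)
    (x : 'M[R]_(n, d)) (v : 'cV[R]_n) (g : fn) : Prop :=
  G g /\ forall h, G h -> (criterion pen x v g <= criterion pen x v h)%E.

(* Along any directions v_1, ..., v_q, every one of the q minimizations is the
   same linear smoother L (depending on the design only) applied to the
   correspondingly rotated data. *)
Definition direction_invariant n p q (G : 'I_q -> set fn)
    (pen : 'I_q -> fn -> \bar R) (L : 'M[R]_(n, d) -> 'M[R]_n) : Prop :=
  forall (x : 'M[R]_(n, d)) (y : 'M[R]_(n, p)) (v : 'M[R]_(p, q)) (k : 'I_q),
  design_in_cube x ->
  (exists g, is_minimizer (G k) (pen k) x (y *m col k v) g) /\
  (forall g, is_minimizer (G k) (pen k) x (y *m col k v) g ->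
     values x g = L x *m (y *m col k v)).

End Procedure.

Arguments direction_invariant {R d n} p {q} G pen L.

Section Rate.
Context (R : realType) (disp : measure_display) (T : measurableType disp).
Variable P : probability T R.

Definition attains_rate n d p q (L : 'M[R]_(n, d) -> 'M[R]_n)
    (U : 'M[R]_(p, q)) (f : 'I_q -> 'rV[R]_d -> R)
    (X : T -> 'M[R]_(n, d)) (Y : T -> 'M[R]_(n, p)) (C r : R) : Prop :=
  forall k : 'I_q,
  ('E_P[fun w => empnorm2 (L (X w) *m (Y w *m col k U) - values (X w) (f k))]
     <= (C * n%:R `^ (- r))%:E)%E.

End Rate.

(* Main.v *)
Require Import Defs.
From HB Require Import structures.
From mathcomp Require Import all_boot all_order all_algebra.
From mathcomp Require Import all_classical all_reals all_analysis.
From mathcomp Require Import measurable_realfun.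
From mathcomp Require Import ring lra.

Set Implicit Arguments.
Unset Strict Implicit.
Unset Printing Implicit Defensive.

Import Order.TTheory GRing.Theory Num.Theory.
Import numFieldNormedType.Exports.

Local Open Scope classical_set_scope.
Local Open Scope ring_scope.

(** Write $F_x$ for the $n \times q$ matrix of the values $f_k(x_i)$, so that
    $Y = F_x U^T + Z$, and $P_U = U U^T$, $P_{\hat U} = \hat U \hat U^T$.  Direction
    invariance says that the fitted values of $\hat F$ are $L Y P_{\hat U}$, while
    those of the oracle are $L Y P_U$.  Hence $n R_n(\hat F)$ is at most twice the
    total squared error of the oracle, whose expectation is $O(q n^{1-r})$, plus a
    multiple of $\|Y (P_{\hat U} - P_U)\|_F^2$, since $L$ is bounded
    ([risk_decomposition]).

    Signal and noise are treated separately in this last term.  With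
    $N = U^T \hat U$, the signal part $\|F_x U^T (P_{\hat U} - P_U)\|_F^2$ equals
    $\|F_x\|_F^2 - \|F_x N\|_F^2$, and $\|P_{\hat U} - P_U\|_F^2 = 2 (q - \|N\|_F^2)$.
    By the Rayleigh principle the smallest eigenvalue of $N N^T$ is the squared
    cosine of the largest principal angle, so these are at most
    $\tau^2 \|F_x\|_F^2 \le \tau^2 n q B^2$ and $2 q \tau^2$, with
    $\tau = \|\sin \Theta(\hat U, U)\|$ ([cosine_deficit_le_sinTheta]).  The
    Frobenius norm of the signal has the right order.  For the noise one gets
    $2 q \tau^2 \|Z\|^2$, and what remains is $E \|Z\|^4 = O(n^2)$ when $p = O(n)$.

    The operator norm of $Z$ is handled by a union bound.  A linear functional does not
    decrease when each coordinate of its argument is moved to a suitable neighbouring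
    integer; rounding both arguments of $u^T Z v$ in this way shows that
    $\sqrt{n p} \|Z\|$ is at most the maximum of $l^T Z k$ over integer vectors with
    $\|l\|^2 \le 4 n$ and $\|k\|^2 \le 4 p$ ([frob2_mul_lattice]).  There are at most
    $64^{n + p}$ such pairs ([card_lattice_ball]), and each $l^T Z k / \sqrt p$ is
    Gaussian of variance at most $16 \sigma^2 n$; therefore the sum $\Phi$ of the
    exponentials $e^{l^T Z k / \sqrt p}$ has expectation at most $e^{c n}$
    ([expectation_lattice_exp_sum]).  As $\|Z\|^2 \le (\ln \Phi)^2 / n$, the moment
    bound follows from $(\ln \Phi / n)^4 \le 8 c^4 + 192 e^{-c n} \Phi$.
    Independence of the entries of $Z$ enters through the product rule for
    expectations ([expectation_prod_of_product_rule]).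

    Finally $\tau^2 \|Z\|^2 / n$ and $\tau^2$ are split by the arithmetic-geometric
    inequality with the deterministic weight $p / n$, which leaves only
    $E \tau^4 \le C (p / n)^2$ and the fourth moment of $\|Z\|$.  All terms are
    then $O(q p / n)$, and $p / n = n^{-r} p n^{-(1 - r)}$.  Since $\tau$ is not known
    to be measurable, the bound is carried by polynomials in $\hat U$ that lie below
    $\tau^2$ ([signal_deficit], [subspace_deficit]). *)

(** * Squared Frobenius norms and quadratic forms *)

Section SquaredFrobeniusNorm.
Variable R : realType.

Definition frob2 m n (A : 'M[R]_(m, n)) : R := \sum_i \sum_j A i j ^+ 2.

Lemma frob2_trace m n (A : 'M[R]_(m, n)) : frob2 A = \tr (A *m A^T).
Proof.
rewrite /mxtrace; apply: eq_bigr => i _; rewrite mxE.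
by apply: eq_bigr => j _; rewrite mxE expr2.
Qed.

Lemma frob2_ge0 m n (A : 'M[R]_(m, n)) : 0 <= frob2 A.
Proof. by apply: sumr_ge0 => i _; apply: sumr_ge0 => j _; exact: sqr_ge0. Qed.

Lemma frob2_tr m n (A : 'M[R]_(m, n)) : frob2 A^T = frob2 A.
Proof. by rewrite !frob2_trace trmxK mxtrace_mulC. Qed.

Lemma frob2N m n (A : 'M[R]_(m, n)) : frob2 (- A) = frob2 A.
Proof.
by apply: eq_bigr => i _; apply: eq_bigr => j _; rewrite mxE sqrrN.
Qed.

Lemma frob2Z m n c (A : 'M[R]_(m, n)) : frob2 (c *: A) = c ^+ 2 * frob2 A.
Proof.
rewrite /frob2 mulr_sumr; apply: eq_bigr => i _.
by rewrite mulr_sumr; apply: eq_bigr => j _; rewrite mxE exprMn.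
Qed.

Lemma frob2_1 q : frob2 (1%:M : 'M[R]_q) = q%:R.
Proof. by rewrite frob2_trace trmx1 mulmx1 mxtrace1. Qed.

Lemma frob2_0 m n : frob2 (0 : 'M[R]_(m, n)) = 0.
Proof. by rewrite frob2_trace mul0mx linear0. Qed.

Lemma frob2_eq0 m n (A : 'M[R]_(m, n)) : frob2 A = 0 -> A = 0.
Proof.
move=> /eqP; rewrite psumr_eq0; last first.
  by move=> i _; apply: sumr_ge0 => j _; exact: sqr_ge0.
move=> /allP A0; apply/matrixP => i j; rewrite mxE; apply/eqP.
have := A0 i; rewrite mem_index_enum => /(_ isT) /=.
rewrite psumr_eq0; last by move=> k _; exact: sqr_ge0.
by move=> /allP/(_ j); rewrite mem_index_enum sqrf_eq0 => /(_ isT).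
Qed.

Lemma frob2_rows m n (A : 'M[R]_(m, n)) : frob2 A = \sum_i frob2 (row i A).
Proof.
apply: eq_bigr => i _; rewrite /frob2 big_ord1.
by apply: eq_bigr => j _; rewrite mxE.
Qed.

Lemma frob2_cols m n (A : 'M[R]_(m, n)) : frob2 A = \sum_j frob2 (col j A).
Proof.
by rewrite -frob2_tr frob2_rows; apply: eq_bigr => j _; rewrite -tr_col frob2_tr.
Qed.

Lemma enorm_sqr n (v : 'cV[R]_n) : enorm v ^+ 2 = frob2 v.
Proof.
rewrite sqr_sqrtr; last by apply: sumr_ge0 => i _; exact: sqr_ge0.
by apply: eq_bigr => i _; rewrite big_ord1.
Qed.

Lemma enorm_frob2 n (v : 'cV[R]_n) : enorm v = Num.sqrt (frob2 v).
Proof. by rewrite -enorm_sqr sqrtr_sqr ger0_norm ?sqrtr_ge0. Qed.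

Lemma frob2D m n (A B : 'M[R]_(m, n)) :
  frob2 (A + B) <= 2 * frob2 A + 2 * frob2 B.
Proof.
rewrite /frob2 !mulr_sumr -big_split; apply: ler_sum => i _ /=.
rewrite !mulr_sumr -big_split; apply: ler_sum => j _ /=; rewrite mxE.
have := sqr_ge0 (A i j - B i j); nra.
Qed.

Lemma frob2B m n (A B : 'M[R]_(m, n)) :
  frob2 (A - B) = frob2 A + frob2 B - 2 * \tr (A *m B^T).
Proof.
rewrite !frob2_trace linearB mulmxBr !mulmxBl !linearB /=.
rewrite -(mxtrace_tr (B *m A^T)) trmx_mul trmxK; ring.
Qed.

Lemma frob2_mul_isometry m p q (A : 'M[R]_(m, q)) (V : 'M[R]_(p, q)) :
  orthonormal_cols V -> frob2 (A *m V^T) = frob2 A.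
Proof.
move=> oV.
by rewrite !frob2_trace trmx_mul trmxK mulmxA -(mulmxA A) oV mulmx1.
Qed.

End SquaredFrobeniusNorm.

Section QuadraticForms.
Variable R : realType.

Definition form n (S : 'M[R]_n) (x y : 'rV[R]_n) : R := (x *m S *m y^T) 0 0.

Lemma formDl n (S : 'M[R]_n) x x' y : form S (x + x') y = form S x y + form S x' y.
Proof. by rewrite /form !mulmxDl mxE. Qed.

Lemma formDr n (S : 'M[R]_n) x y y' : form S x (y + y') = form S x y + form S x y'.
Proof. by rewrite /form linearD mulmxDr mxE. Qed.

Lemma formZl n (S : 'M[R]_n) c x y : form S (c *: x) y = c * form S x y.
Proof. by rewrite /form -!scalemxAl mxE. Qed.

Lemma formZr n (S : 'M[R]_n) c x y : form S x (c *: y) = c * form S x y.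
Proof. by rewrite /form linearZ -scalemxAr mxE. Qed.

Lemma formC n (S : 'M[R]_n) x y : S^T = S -> form S y x = form S x y.
Proof.
move=> sS; rewrite /form.
have -> : y *m S *m x^T = (x *m S *m y^T)^T.
  by rewrite !trmx_mul trmxK sS mulmxA.
by rewrite mxE.
Qed.

Lemma form_frob2 n (x : 'rV[R]_n) : form 1%:M x x = frob2 x.
Proof. by rewrite /form mulmx1 frob2_trace /mxtrace big_ord1. Qed.

(** The discriminant of the nonnegative quadratic form $(s, t) \mapsto Q(s x + t y)$;
    well-chosen values of $s$ and $t$ avoid dividing by $Q(y)$, which may vanish. *)
Lemma psd_form_cauchy n (S : 'M[R]_n) x y :
  S^T = S -> (forall z, 0 <= form S z z) ->
  form S x y ^+ 2 <= form S x x * form S y y.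
Proof.
move=> sS pS; set b := form S x y; set c := form S y y; set a := form S x x.
have Q s t : 0 <= s ^+ 2 * a + 2 * s * t * b + t ^+ 2 * c.
  have := pS (s *: x + t *: y).
  rewrite formDl !formDr !formZl !formZr (formC x y sS) -/a -/b -/c; lra.
have c0 : 0 <= c := pS y.
have a0 : 0 <= a := pS x.
have [c_gt0|] := ltrP 0 c.
  have := Q c (- b).
  have -> : c ^+ 2 * a + 2 * c * (- b) * b + (- b) ^+ 2 * c
            = c * (a * c - b ^+ 2) by ring.
  by rewrite pmulr_rge0// subr_ge0.
move=> c_le0; have {c0 c_le0} c0 : c = 0 by apply/eqP; rewrite eq_le c_le0 c0.
have := Q b (- (a + 1)); rewrite c0 !mulr0 addr0.
have := sqr_ge0 b; have := mulr_ge0 a0 (sqr_ge0 b); nra.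
Qed.

Lemma form_cauchy n (x y : 'rV[R]_n) :
  form 1%:M x y ^+ 2 <= frob2 x * frob2 y.
Proof.
rewrite -!form_frob2; apply: psd_form_cauchy; first by rewrite trmx1.
by move=> z; rewrite form_frob2 frob2_ge0.
Qed.

Lemma frob2_mul_rV n m (x : 'rV[R]_n) (A : 'M[R]_(n, m)) :
  frob2 (x *m A) = form (A *m A^T) x x.
Proof. by rewrite frob2_trace /mxtrace big_ord1 trmx_mul /form !mulmxA. Qed.

Lemma frob2_mul m n k (A : 'M[R]_(m, n)) (B : 'M[R]_(n, k)) :
  frob2 (A *m B) <= frob2 A * frob2 B.
Proof.
rewrite [X in _ <= X * _]frob2_rows mulr_suml; apply: ler_sum => i _.
rewrite (frob2_cols B) mulr_sumr; apply: ler_sum => j _.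
have := form_cauchy (row i A) (col j B)^T.
rewrite frob2_tr; congr (_ <= _); congr (_ ^+ 2).
rewrite /form mulmx1 trmxK !mxE.
by apply: eq_bigr => l _; rewrite !mxE.
Qed.

End QuadraticForms.

(** * Smallest eigenvalue of a real symmetric matrix *)

Section SmallestEigenvalue.
Variable R : realType.

Lemma continuous_sum (T : topologicalType) (I : finType) (F : I -> T -> R) :
  (forall i, continuous (F i)) -> continuous (fun x => \sum_i F i x).
Proof.
move=> cF; apply: (@continuous_big R); first exact: add_continuous.
by move=> i _; exact: cF.
Qed.

Lemma continuous_form n (S : 'M[R]_n) : continuous (fun x : 'rV[R]_n => form S x x).
Proof.
have -> : (fun x : 'rV[R]_n => form S x x) =
    (fun x => \sum_j (\sum_k x 0 k * S k j) * x 0 j).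
  apply/funext => x; rewrite /form mxE; apply: eq_bigr => j _.
  by rewrite !mxE.
have cS j : continuous (fun x : 'rV[R]_n => \sum_k x 0 k * S k j).
  apply: continuous_sum => k x.
  apply: (@continuousM R 'rV[R]_n (fun x => x 0 k) (fun=> S k j)).
    exact: coord_continuous.
  exact: cst_continuous.
apply: continuous_sum => j x.
apply: (@continuousM R 'rV[R]_n _ (fun x => x 0 j)); first exact: cS.
exact: coord_continuous.
Qed.


Lemma frob2_continuous n : continuous (@frob2 R 1 n).
Proof.
have -> : @frob2 R 1 n = (fun x => form 1%:M x x).
  by apply/funext => x; rewrite form_frob2.
exact: continuous_form.
Qed.

Lemma unit_sphere_compact n : compact [set x : 'rV[R]_n | frob2 x = 1].
Proof.
apply: bounded_closed_compact.
  exists 1; split => [|M M1 x /= x1]; first exact: num_real.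
  rewrite [leLHS]/Num.norm /= mx_normrE; apply/bigmax_leP; split=> [|[i j] _ /=].
    exact: ltW (lt_trans ltr01 M1).
  apply: le_trans (ltW M1); rewrite -(@expr_le1 _ 2)// real_normK ?num_real//.
  rewrite -x1 /frob2 big_ord1 ord1 (bigD1 j)//= lerDl.
  by apply: sumr_ge0 => k _; exact: sqr_ge0.
rewrite (_ : mkset _ = @frob2 R 1 n @^-1` [set 1]) //.
by apply: preimage_closed => [x _|]; [exact: frob2_continuous|exact: closed_eq].
Qed.

(** The minimum of the Rayleigh quotient is attained, by compactness of the
    sphere.  At a minimizer the nonnegative form $S - \mu$ vanishes, so by the
    Cauchy-Schwarz inequality for that form the minimizer lies in its kernel. *)
Lemma smallest_eigenvalue n (S : 'M[R]_n.+1) : S^T = S ->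
  exists2 mu, eigenvalue S mu & forall x, mu * frob2 x <= form S x x.
Proof.
move=> sS.
have sphere0 : [set x : 'rV[R]_n.+1 | frob2 x = 1] !=set0.
  exists (delta_mx 0 0) => /=; rewrite /frob2 big_ord1 (bigD1 0)//= mxE !eqxx.
  rewrite expr1n big1 ?addr0// => j /negbTE j0.
  by rewrite mxE j0 andbF expr0n.
have [||x0] := @EVT_min_rV R _ (fun x => form S x x) _ sphere0.
- exact: unit_sphere_compact.
- by apply: continuous_subspaceT; exact: continuous_form.
rewrite inE /= => x01 x0min; set mu := form S x0 x0 in x0min.
have mu_min x : mu * frob2 x <= form S x x.
  have [x_0|x_neq0] := eqVneq (frob2 x) 0.
    by rewrite x_0 (frob2_eq0 x_0) mulr0 /form !mul0mx mxE.
  have x_gt0 : 0 < frob2 x by rewrite lt_neqAle eq_sym x_neq0 frob2_ge0.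
  have /x0min : (Num.sqrt (frob2 x))^-1 *: x \in [set x | frob2 x = 1].
    rewrite inE /= frob2Z exprVn sqr_sqrtr ?frob2_ge0//.
    by rewrite mulVf.
  rewrite formZl formZr mulrA -expr2 exprVn sqr_sqrtr ?frob2_ge0//.
  by rewrite mulrC ler_pdivlMr.
exists mu => //; apply/eigenvalueP; exists x0; last first.
  by apply: contra_eq_neq x01 => ->; rewrite frob2_0 eq_sym oner_neq0.
set S' := S - mu%:M.
have formS' x y : form S' x y = form S x y - mu * form 1%:M x y.
  by rewrite /form /S' mulmxBr mulmxBl mul_mx_scalar -scalemxAl mulmx1 !mxE.
have sS' : S'^T = S' by rewrite /S' linearB /= sS tr_scalar_mx.
have pS' x : 0 <= form S' x x by rewrite formS' form_frob2 subr_ge0.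
have S'x0 y : form S' x0 y = 0.
  apply/eqP; rewrite -sqrf_eq0 eq_le sqr_ge0 andbT.
  have := psd_form_cauchy x0 y sS' pS'.
  by rewrite [form S' x0 x0]formS' form_frob2 x01 mulr1 subrr mul0r.
have : x0 *m S' = 0.
  by apply: frob2_eq0; rewrite -form_frob2 -[RHS](S'x0 (x0 *m S')) /form mulmx1.
by rewrite /S' mulmxBr mul_mx_scalar => /eqP; rewrite subr_eq0 => /eqP.
Qed.

End SmallestEigenvalue.

(** * Spectral norm and principal angles *)

Section SpectralNorm.
Variable R : realType.

(** The Frobenius norm is an upper bound, so that [sup] is a genuine supremum. *)
Lemma spectral_norm_has_ubound m n (A : 'M[R]_(m, n)) :
  has_ubound [set enorm (A *m v) | v in [set v : 'cV[R]_n | enorm v <= 1]].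
Proof.
exists (Num.sqrt (frob2 A)) => _ [v /= v1 <-].
rewrite enorm_frob2 ler_wsqrtr// (le_trans (frob2_mul _ _))//.
by rewrite ler_piMr ?frob2_ge0// -enorm_sqr expr_le1 ?sqrtr_ge0.
Qed.

Lemma spectral_norm_ge0 m n (A : 'M[R]_(m, n)) : 0 <= spectral_norm A.
Proof.
apply: (@ub_le_sup _ _ (spectral_norm_has_ubound A)) => /=; exists 0.
  by rewrite enorm_frob2 frob2_0 sqrtr0.
by rewrite mulmx0 enorm_frob2 frob2_0 sqrtr0.
Qed.

Lemma frob2_spectral m n k (A : 'M[R]_(m, n)) (B : 'M[R]_(n, k)) :
  frob2 (A *m B) <= spectral_norm A ^+ 2 * frob2 B.
Proof.
rewrite (frob2_cols (A *m B)) (frob2_cols B) mulr_sumr.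
apply: ler_sum => j _; rewrite colE -mulmxA -colE; set v := col j B.
have [v_0|v_neq0] := eqVneq (frob2 v) 0.
  by rewrite v_0 (frob2_eq0 v_0) mulmx0 mulr0 frob2_0.
have v_gt0 : 0 < frob2 v by rewrite lt_neqAle eq_sym v_neq0 frob2_ge0.
set u := (Num.sqrt (frob2 v))^-1 *: v.
have : enorm (A *m u) <= spectral_norm A.
  apply: (@ub_le_sup _ _ (spectral_norm_has_ubound A)); exists u => //=.
  by rewrite enorm_frob2 frob2Z exprVn sqr_sqrtr ?frob2_ge0// mulVf// sqrtr1.
rewrite -(@ler_pXn2r _ 2 _ (enorm _)) ?nnegrE ?sqrtr_ge0 ?spectral_norm_ge0//.
rewrite enorm_sqr -scalemxAr frob2Z exprVn sqr_sqrtr ?frob2_ge0//.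
by rewrite mulrC ler_pdivrMr.
Qed.

Lemma entry_le_spectral_norm q (a : 'rV[R]_q) i :
  a 0 i <= spectral_norm (diag_mx a).
Proof.
apply: le_trans (ler_norm _) _.
rewrite -(@ler_pXn2r _ 2) ?nnegrE ?spectral_norm_ge0// real_normK ?num_real//.
have := frob2_spectral (diag_mx a) (delta_mx i 0 : 'cV_q).
rewrite mul_diag_mx; congr (_ <= _).
  rewrite /frob2 (bigD1 i)//= [X in _ + X]big1 ?addr0.
    by rewrite big_ord1 !mxE !eqxx mulr1.
  by move=> j ji; rewrite big_ord1 !mxE (negbTE ji) mulr0 expr0n.
rewrite /frob2 (bigD1 i)//= [X in _ + X]big1 ?addr0.
  by rewrite big_ord1 !mxE !eqxx expr1n mulr1.
by move=> j ji; rewrite big_ord1 !mxE (negbTE ji) expr0n.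
Qed.

End SpectralNorm.

Section PrincipalAngles.
Variable R : realType.

(** $A U^T$ is the signal and $V V^T$ the estimated projection: by Pythagoras
    the signal loses what it does not keep along the columns of $V$. *)
Lemma frob2_projection_defect p q m (V U : 'M[R]_(p, q)) (A : 'M[R]_(m, q)) :
  orthonormal_cols V -> orthonormal_cols U ->
  frob2 (A *m U^T *m (V *m V^T - U *m U^T)) =
  frob2 A - frob2 (A *m (U^T *m V)).
Proof.
move=> oV oU; have -> : A *m U^T *m (V *m V^T - U *m U^T) =
    A *m (U^T *m V) *m V^T - A *m U^T.
  by rewrite mulmxBr !mulmxA -(mulmxA A _ U) oU mulmx1.
rewrite frob2B !frob2_mul_isometry//.
have -> : A *m (U^T *m V) *m V^T *m (A *m U^T)^T =
    A *m (U^T *m V) *m (A *m (U^T *m V))^T.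
  by rewrite !trmx_mul !trmxK !mulmxA.
rewrite -frob2_trace; ring.
Qed.

Lemma frob2_orthonormal p q (V : 'M[R]_(p, q)) :
  orthonormal_cols V -> frob2 V = q%:R.
Proof. by move=> oV; rewrite -frob2_tr frob2_trace trmxK oV mxtrace1. Qed.

(** Two projections of the same rank $q$: only the cross term
    $\mathrm{tr}(V V^T U U^T) = \|U^T V\|_F^2$ is not constant. *)
Lemma frob2_projectionB p q (V U : 'M[R]_(p, q)) :
  orthonormal_cols V -> orthonormal_cols U ->
  frob2 (V *m V^T - U *m U^T) = 2 * (q%:R - frob2 (U^T *m V)).
Proof.
move=> oV oU; rewrite frob2B !frob2_mul_isometry//.
rewrite (frob2_orthonormal oV) (frob2_orthonormal oU) frob2_trace !trmx_mul !trmxK.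
rewrite !mulmxA (mxtrace_mulC _ U^T) !mulmxA; ring.
Qed.

(** With $N = U^T V$ and $\mu$ the smallest eigenvalue of $N N^T$, every row [a]
    satisfies $\|a N\|^2 \ge \mu \|a\|^2$, and $\mu$ is the square of a singular
    value, that is, of the cosine of an angle whose squared sine is $1 - \mu$. *)
Lemma cosine_deficit_le_sinTheta p q (V U : 'M[R]_(p, q)) m (A : 'M[R]_(m, q)) :
  orthonormal_cols V -> orthonormal_cols U ->
  frob2 A - frob2 (A *m (U^T *m V)) <=
  spectral_norm (sinTheta V U) ^+ 2 * frob2 A.
Proof.
move=> oV oU; set N := U^T *m V; set tau := spectral_norm _.
suff row_case (a : 'rV[R]_q) : frob2 a - frob2 (a *m N) <= tau ^+ 2 * frob2 a.
  rewrite (frob2_rows A) (frob2_rows (A *m N)) -sumrB mulr_sumr.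
  by apply: ler_sum => i _; rewrite row_mul; exact: row_case.
case: q => [|q] in V U A oV oU N tau a *.
  have -> : a = 0 by apply/matrixP => i [].
  by rewrite mul0mx subrr mulr_ge0 ?sqr_ge0 ?frob2_ge0.
suff [mu mu_min mu_tau] : exists2 mu,
    forall x : 'rV_q.+1, mu * frob2 x <= frob2 (x *m N) & 1 - mu <= tau ^+ 2.
  rewrite (@le_trans _ _ ((1 - mu) * frob2 a))//.
    by rewrite mulrBl mul1r lerD2l lerN2.
  by rewrite ler_wpM2r ?frob2_ge0.
have tau0 : 0 <= tau := spectral_norm_ge0 _.
have sin_le i : sin (acos (singular_values (V^T *m U) 0 i)) <= tau.
  by have := entry_le_spectral_norm (map_mx sin (principal_angles V U)) i;
    rewrite !mxE.
have [[s sP]|noS] := pselect (exists s, is_singular_values (V^T *m U) s); last first.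
  (* The default singular value 0 is the cosine of a right angle. *)
  exists 0 => [x|]; first by rewrite mul0r frob2_ge0.
  have := sin_le 0; rewrite /singular_values xgetPN => [|s sS]; last first.
    by apply: noS; exists s.
  rewrite mxE acos0 sin_pihalf subr0; exact: exprn_ege1.
have sS : is_singular_values (V^T *m U) (singular_values (V^T *m U)).
  exact: (xgetPex 0 (ex_intro _ s sP)).
move: sin_le sS; set t := singular_values _ => sin_le [t_ge0 _ chi].
have NE : N *m N^T = (V^T *m U)^T *m (V^T *m U).
  by rewrite /N !trmx_mul !trmxK.
have [|mu] := @smallest_eigenvalue R q (N *m N^T).
  by rewrite trmx_mul trmxK.
rewrite eigenvalue_root_char NE chi -NE.
rewrite -(big_map (fun i => t 0 i ^+ 2) xpredT (fun z => 'X - z%:P)).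
rewrite root_prod_XsubC => /mapP[i _ ->] mu_min; exists (t 0 i ^+ 2).
  by move=> x; rewrite frob2_mul_rV.
(* [sin_acos] needs a cosine in the unit interval, and [N] is a contraction. *)
have ti_le1 : t 0 i ^+ 2 <= 1.
  pose e : 'rV[R]_q.+1 := delta_mx 0 0.
  have e1 : frob2 e = 1.
    rewrite /frob2 big_ord1 (bigD1 0)//= mxE !eqxx expr1n big1 ?addr0//.
    by move=> j j0; rewrite mxE (negbTE j0) expr0n.
  rewrite -(mulr1 (_ ^+ 2)) -e1 (le_trans (mu_min e))// -frob2_mul_rV.
  by rewrite -subr_ge0 -(frob2_projection_defect e oV oU) frob2_ge0.
have := sin_le i; rewrite sin_acos; last first.
  rewrite (le_trans _ (t_ge0 i)) ?lerN10//=.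
  by rewrite -(@expr_le1 _ 2).
move=> sin_le_tau; rewrite -(@sqr_sqrtr _ (1 - t 0 i ^+ 2)) ?subr_ge0//.
by rewrite ler_pXn2r ?nnegrE ?sqrtr_ge0.
Qed.

End PrincipalAngles.

(** * Deterministic decomposition of the risk *)

Section RiskDecomposition.
Variables (R : realType) (n d p q : nat).
Implicit Types (x : 'M[R]_(n, d)) (f g : 'I_q -> 'rV[R]_d -> R).

Definition design_values x f : 'M[R]_(n, q) := \matrix_(i, k) f k (row i x).

Lemma regression_fun_row (U : 'M[R]_(p, q)) f x i :
  regression_fun U f (row i x) = (row i (design_values x f *m U^T))^T.
Proof.
apply/matrixP => j l; rewrite summxE !mxE; apply: eq_bigr => k _.
by rewrite !mxE.
Qed.

Lemma risk_frob2 (U V : 'M[R]_(p, q)) f g x :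
  risk x (regression_fun U f) (regression_fun V g) =
  n%:R^-1 * frob2 (design_values x f *m U^T - design_values x g *m V^T).
Proof.
rewrite /risk frob2_rows; congr (_ * _); apply: eq_bigr => i _.
by rewrite enorm_sqr !regression_fun_row -linearB /= frob2_tr -linearB.
Qed.

Lemma design_values_fitted (L : 'M[R]_n) (y : 'M[R]_(n, p)) (V : 'M[R]_(p, q)) g x :
  (forall k, values x (g k) = L *m (y *m col k V)) ->
  design_values x g = L *m (y *m V).
Proof.
move=> gL; apply/matrixP => i k; rewrite mxE.
have := congr1 (fun v : 'cV_n => v i 0) (gL k); rewrite /= mxE => ->.
by rewrite !colE !mulmxA -colE mxE.
Qed.

Lemma sum_empnorm2_frob2 (L : 'M[R]_n) (y : 'M[R]_(n, p)) (U : 'M[R]_(p, q)) f x :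
  \sum_k empnorm2 (L *m (y *m col k U) - values x (f k)) =
  n%:R^-1 * frob2 (L *m (y *m U) - design_values x f).
Proof.
rewrite frob2_cols mulr_sumr; apply: eq_bigr => k _.
have -> : L *m (y *m col k U) = col k (L *m (y *m U)).
  by rewrite !colE !mulmxA.
rewrite /empnorm2 enorm_sqr; congr (_ * frob2 _).
by apply/matrixP => i j; rewrite !mxE.
Qed.

(** With $P_U = U U^T$ and $P_V = V V^T$, the fit is $L y P_V$ and the oracle
    fit is $L y P_U$: the difference of the two is $L y (P_V - P_U)$, and
    $y = F_x + z$. *)
Lemma risk_decomposition (L : 'M[R]_n) (y z : 'M[R]_(n, p)) (U V : 'M[R]_(p, q))
    f g x :
  orthonormal_cols U ->
  (forall k, values x (g k) = L *m (y *m col k V)) ->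
  y = design_values x f *m U^T + z ->
  risk x (regression_fun U f) (regression_fun V g) <=
  2 * \sum_k empnorm2 (L *m (y *m col k U) - values x (f k)) +
  4 * spectral_norm L ^+ 2 * n%:R^-1 *
    (frob2 (design_values x f *m U^T *m (V *m V^T - U *m U^T)) +
     frob2 (z *m (V *m V^T - U *m U^T))).
Proof.
move=> oU fitted yE; set D := _ - _; set Fx := design_values x f.
rewrite risk_frob2 (design_values_fitted fitted) sum_empnorm2_frob2 -/Fx.
have -> : Fx *m U^T - L *m (y *m V) *m V^T =
    (Fx - L *m (y *m U)) *m U^T - L *m (y *m D).
  by rewrite /D mulmxBl !mulmxBr opprB !mulmxA addrA subrK.
have step1 := frob2D ((Fx - L *m (y *m U)) *m U^T) (- (L *m (y *m D))).
rewrite frob2N frob2_mul_isometry// -(frob2N (Fx - _)) opprB in step1.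
have step2 := frob2_spectral L (y *m D).
have step3 := frob2D (Fx *m U^T *m D) (z *m D); rewrite -mulmxDl -yE in step3.
have n1 : 0 <= (n%:R : R)^-1 by rewrite invr_ge0.
have sL := sqr_ge0 (spectral_norm L).
have step4 : frob2 (L *m (y *m D)) <= spectral_norm L ^+ 2 *
    (2 * frob2 (Fx *m U^T *m D) + 2 * frob2 (z *m D)).
  by apply: le_trans step2 _; rewrite ler_wpM2l.
have step5 := le_trans step1 (lerD (lexx _) (ler_wpM2l (ler0n _ 2) step4)).
have := ler_wpM2l n1 step5; lra.
Qed.

(** The arithmetic-geometric inequality with the deterministic weight [a]
    replaces the Cauchy-Schwarz inequality for expectations. *)
Lemma weighted_am_gm (a s t : R) : 0 < a -> 2 * (s * t) <= a * s ^+ 2 + t ^+ 2 / a.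
Proof.
move=> a0; rewrite -(ler_pM2r a0) [leRHS]mulrDl divfK ?gt_eqF//.
have := sqr_ge0 (a * s - t); nra.
Qed.

End RiskDecomposition.

(** * Rounding to a lattice *)

Section LatticeDiscretization.
Variable R : realType.

(** Points of $\mathbb{Z}^m$ by sign and magnitude.  Magnitudes up to $4 m$ suffice
    for the ball $\|k\|^2 \le 4 m$, and sums over all codes factorize. *)
Definition lattice_code m : finType := {ffun 'I_m -> bool * 'I_(4 * m).+1}.

Definition lattice_entry m (k : lattice_code m) (i : 'I_m) : R :=
  (-1) ^+ (k i).1 * (k i).2%:R.

Definition in_lattice_ball m (k : lattice_code m) : bool :=
  (\sum_i (k i).2 ^ 2 <= 4 * m)%N.

Lemma lattice_entry_sum m (k : lattice_code m) : in_lattice_ball k ->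
  \sum_i lattice_entry k i ^+ 2 <= 4 * m%:R.
Proof.
rewrite /in_lattice_ball -(ler_nat R) natrM natr_sum; apply: le_trans.
by apply: ler_sum => i _; rewrite /lattice_entry exprMn sqrr_sign mul1r natrX.
Qed.

Lemma round_entry (c v : R) : exists (b : bool) (a : nat),
  c * v <= c * ((-1) ^+ b * a%:R) /\ a%:R <= `|v| + 1.
Proof.
exists (v < 0)%R; have [a aP] : exists a : nat, a%:R <= `|v| < a.+1%:R.
  by exists (Num.truncn `|v|); exact: truncn_itv.
set s := c * (-1) ^+ (v < 0)%R.
have -> : c * v = s * `|v| by rewrite /s -mulrA -numEsign.
move: aP => /andP[a_le a_gt].
have [s0|s0] := lerP 0 s.
  exists a.+1; rewrite !mulrA -/s; split; last by rewrite -natr1 lerD2r.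
  by rewrite ler_wpM2l// ltW.
exists a; rewrite !mulrA -/s; split; last by rewrite ler_wpDr.
by rewrite ler_wnM2l// ltW.
Qed.

(** A linear functional over a box is maximal at a vertex; here the box is the unit
    cell of the integer lattice around [v].  The ball grows by a factor of two in
    radius because each coordinate moves by at most one. *)
Lemma lattice_dominates m (c v : 'I_m -> R) : \sum_i v i ^+ 2 <= m%:R ->
  exists2 k : lattice_code m, in_lattice_ball k &
    \sum_i c i * v i <= \sum_i c i * lattice_entry k i.
Proof.
move=> vm.
have /choice[b /choice[a ab]] : forall i, exists (b : bool) (a : nat),
    c i * v i <= c i * ((-1) ^+ b * a%:R) /\ a%:R <= `|v i| + 1.
  by move=> i; exact: round_entry.
have a_sum : (\sum_i a i ^ 2 <= 4 * m)%N.
  rewrite -(ler_nat R) natr_sum natrM.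
  apply: (@le_trans _ _ (\sum_i (2 * v i ^+ 2 + 2))).
    apply: ler_sum => i _; have [_ ai] := ab i; rewrite natrX.
    rewrite (@le_trans _ _ ((`|v i| + 1) ^+ 2))//.
      by rewrite ler_pXn2r ?nnegrE ?addr_ge0.
    rewrite -[X in _ <= 2 * X + _]real_normK ?num_real//.
    have := sqr_ge0 (`|v i| - 1); nra.
  rewrite big_split /= -mulr_sumr sumr_const card_ord -mulr_natr; lra.
have a_lt i : (a i < (4 * m).+1)%N.
  rewrite ltnS (leq_trans _ a_sum)// (bigD1 i)//= (leq_trans _ (leq_addr _ _))//.
  by case: (a i) => // k; rewrite leq_pmulr.
exists [ffun i => (b i, Ordinal (a_lt i))].
  by rewrite /in_lattice_ball; under eq_bigr do rewrite ffunE.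
apply: ler_sum => i _; rewrite /lattice_entry ffunE /=.
by have [] := ab i.
Qed.

(** On the ball $\sum_i |k_i| \le \sum_i k_i^2 \le 4 m$, so each point has
    weight at least one in $16^m \prod_i 2^{-|k_i|}$, whose sum factorizes. *)
Lemma card_lattice_ball m :
  (#|[pred k : lattice_code m | in_lattice_ball k]|)%:R <= 64 ^+ m :> R.
Proof.
pose w (x : bool * 'I_(4 * m).+1) : R := 2 ^- x.2.
have w0 x : 0 <= w x by rewrite invr_ge0 exprn_ge0.
apply: (@le_trans _ _ (\sum_(k : lattice_code m) 2 ^+ (4 * m) * \prod_i w (k i))).
  rewrite -sum1_card natr_sum /= [leRHS](bigID (@in_lattice_ball m)) /= -[leLHS]addr0.
  apply: lerD; last first.
    by apply: sumr_ge0 => k _; rewrite mulr_ge0 ?exprn_ge0// prodr_ge0.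
  apply: ler_sum => k kball.
  rewrite /w prodfV prodrXr; set s := (\sum_i _)%N.
  rewrite ler_pdivlMr ?exprn_gt0// mul1r ler_eXn2l ?ltr1n//.
  apply: leq_trans kball; apply: leq_sum => i _.
  by case: (nat_of_ord _) => // a; rewrite leq_pmulr.
rewrite -mulr_sumr -(bigA_distr_bigA (fun _ => w)) /= prodr_const card_ord.
rewrite exprM -exprMn lerXn2r ?nnegrE ?mulr_ge0 ?sumr_ge0//.
have geo N : \sum_(a < N) 2 ^- a = 2 - 2 * 2 ^- N :> R.
  elim: N => [|N IH]; first by rewrite big_ord0 expr0 invr1; lra.
  by rewrite big_ord_recr /= IH exprS invfM; lra.
rewrite -(pair_bigA _ (fun (b : bool) (a : 'I_(4 * m).+1) => w (b, a))) /=.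
rewrite /w /= big_bool /= geo.
have : (0 : R) <= 2 ^- (4 * m).+1 by rewrite invr_ge0 exprn_ge0.
lra.
Qed.

End LatticeDiscretization.

(** * Operator norm bounded by a sum of exponentials *)

Section OperatorNormByExponentialSum.
Variable R : realType.

Definition bilinear n p (Z : 'M[R]_(n, p)) (u : 'I_n -> R) (v : 'I_p -> R) : R :=
  \sum_i \sum_j u i * v j * Z i j.

(** A soft maximum of $l^T Z k$ over pairs of lattice points: its logarithm
    bounds the operator norm of [Z], while its expectation is a sum of Gaussian
    moment generating functions. *)
Definition lattice_exp_sum n p (lambda : R) (Z : 'M[R]_(n, p)) : R :=
  \sum_(l : lattice_code n | in_lattice_ball l)
    \sum_(k : lattice_code p | in_lattice_ball k)
      expR (lambda * bilinear Z (lattice_entry R l) (lattice_entry R k)).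

Lemma bilinear_mulmx n p (Z : 'M[R]_(n, p)) (u : 'cV[R]_n) (v : 'cV[R]_p) :
  bilinear Z (fun i => u i 0) (fun j => v j 0) = (u^T *m (Z *m v)) 0 0.
Proof.
rewrite !mxE; apply: eq_bigr => i _; rewrite !mxE mulr_sumr.
by apply: eq_bigr => j _; ring.
Qed.

(** The two vectors are rounded one after the other, each time with the other
    argument of the bilinear form fixed. *)
Lemma expR_bilinear_le_lattice_exp_sum n p lambda (Z : 'M[R]_(n, p)) u v :
  0 <= lambda ->
  \sum_i u i ^+ 2 <= n%:R -> \sum_j v j ^+ 2 <= p%:R ->
  expR (lambda * bilinear Z u v) <= lattice_exp_sum lambda Z.
Proof.
move=> l0 un vp.
have [k kball kP] := lattice_dominates (fun j => \sum_i u i * Z i j) vp.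
have [l lball lP] :=
  lattice_dominates (fun i => \sum_j lattice_entry R k j * Z i j) un.
have uv_lk : bilinear Z u v <= bilinear Z (lattice_entry R l) (lattice_entry R k).
  apply: le_trans (le_trans _ lP) _.
  - rewrite /bilinear exchange_big /=; apply: le_trans (le_trans _ kP) _.
    + by apply: ler_sum => j _; rewrite mulr_suml ler_sum// => i _; lra.
    + under eq_bigr do rewrite mulr_suml; rewrite exchange_big /=.
      by apply: ler_sum => i _; rewrite mulr_suml ler_sum// => j _; lra.
  - by apply: ler_sum => i _; rewrite mulr_suml ler_sum// => j _; lra.
apply: (@le_trans _ _
    (expR (lambda * bilinear Z (lattice_entry R l) (lattice_entry R k)))).
  by rewrite ler_expR ler_wpM2l.
rewrite /lattice_exp_sum (bigD1 l)//= (bigD1 k)//= -addrA lerDl.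
rewrite addr_ge0//.
  by apply: sumr_ge0 => ? _; exact: expR_ge0.
by apply: sumr_ge0 => ? _; apply: sumr_ge0 => ? _; exact: expR_ge0.
Qed.

Lemma lattice_exp_sum_ge1 n p lambda (Z : 'M[R]_(n, p)) :
  0 <= lambda -> 1 <= lattice_exp_sum lambda Z.
Proof.
move=> l0.
have := @expR_bilinear_le_lattice_exp_sum n p lambda Z (fun=> 0) (fun=> 0) l0.
rewrite !big1 => [|i _|i _]; rewrite ?expr0n// => /(_ (ler0n _ _) (ler0n _ _)).
rewrite /bilinear big1 ?mulr0 ?expR0// => i _.
by rewrite big1// => j _; rewrite !mul0r.
Qed.

(** Column by column.  For $u = Z v$ the rescaled vectors
    $\sqrt{n} u / \|u\|$ and $\sqrt{p} v / \|v\|$ have the lengths required for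
    rounding, and on them the form takes the value $\sqrt{n p} \|Z v\| / \|v\|$. *)
Lemma frob2_mul_lattice n p k (Z : 'M[R]_(n, p)) (B : 'M[R]_(p, k)) :
  (0 < n)%N -> (0 < p)%N ->
  frob2 (Z *m B) <=
  ln (lattice_exp_sum (Num.sqrt p%:R)^-1 Z) ^+ 2 / n%:R * frob2 B.
Proof.
move=> n0 p0; set K := ln _.
rewrite (frob2_cols (Z *m B)) (frob2_cols B) mulr_sumr.
apply: ler_sum => j _; rewrite colE -mulmxA -colE; set v := col j B.
set u := Z *m v.
have nR0 : (0 : R) < n%:R by rewrite ltr0n.
have pR0 : (0 : R) < p%:R by rewrite ltr0n.
have [u_0|u_neq0] := eqVneq (frob2 u) 0.
  by rewrite u_0 mulr_ge0 ?frob2_ge0// mulr_ge0 ?sqr_ge0 ?invr_ge0 ?ltW.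
have u_gt0 : 0 < frob2 u by rewrite lt_neqAle eq_sym u_neq0 frob2_ge0.
have v_gt0 : 0 < frob2 v.
  rewrite lt_neqAle frob2_ge0 andbT eq_sym; apply: contraNneq u_neq0 => v0.
  by rewrite /u (frob2_eq0 v0) mulmx0 frob2_0.
set a := Num.sqrt (frob2 u); set b := Num.sqrt (frob2 v).
have a0 : 0 < a by rewrite sqrtr_gt0.
have b0 : 0 < b by rewrite sqrtr_gt0.
have a2 : a ^+ 2 = frob2 u by rewrite sqr_sqrtr ?frob2_ge0.
have b2 : b ^+ 2 = frob2 v by rewrite sqr_sqrtr ?frob2_ge0.
set sn := Num.sqrt (n%:R : R); set sp := Num.sqrt (p%:R : R).
have sn0 : 0 < sn by rewrite sqrtr_gt0.
have sp0 : 0 < sp by rewrite sqrtr_gt0.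
have sn2 : sn ^+ 2 = n%:R by rewrite sqr_sqrtr ?ltW.
have sp2 : sp ^+ 2 = p%:R by rewrite sqr_sqrtr ?ltW.
have sumsq m (x : 'cV[R]_m) : \sum_i x i 0 ^+ 2 = frob2 x.
  by apply: eq_bigr => i _; rewrite big_ord1.
pose u' := (sn / a) *: u; pose v' := (sp / b) *: v.
have : sp^-1 * bilinear Z (fun i => u' i 0) (fun j => v' j 0) <= K.
  have sp1 : 0 <= sp^-1 by rewrite invr_ge0 ltW.
  rewrite -ler_expR lnK; last first.
    by rewrite posrE (lt_le_trans ltr01)// lattice_exp_sum_ge1.
  apply: expR_bilinear_le_lattice_exp_sum => //.
    by rewrite sumsq frob2Z exprMn exprVn a2 sn2 divfK.
  by rewrite sumsq frob2Z exprMn exprVn b2 sp2 divfK ?gt_eqF.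
have -> : sp^-1 * bilinear Z (fun i => u' i 0) (fun j => v' j 0) = sn * a / b.
  rewrite bilinear_mulmx /u' /v' linearZ /= -!scalemxAr -scalemxAl !mxE -/u.
  have -> : \sum_k u^T 0 k * u k 0 = a ^+ 2.
    by rewrite a2 -sumsq; apply: eq_bigr => i _; rewrite mxE expr2.
  by field; rewrite !gt_eqF.
move=> le_K; have le_K2 : (sn * a / b) ^+ 2 <= K ^+ 2.
  have q0 : 0 <= sn * a / b by rewrite divr_ge0 ?mulr_ge0 ?ltW.
  by rewrite ler_pXn2r// nnegrE (le_trans q0).
rewrite -a2 -b2 mulrAC ler_pdivlMr// -sn2.
move: le_K2; rewrite exprMn exprVn ler_pdivrMr ?exprn_gt0// exprMn; lra.
Qed.

(** Either $\ln \Phi \le c n$, or the excess $x = \ln \Phi / n - c$ is positive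
    and $x^4 \le 4! \, e^{x} \le 4! \, e^{n x} = 24 \, e^{-c n} \Phi$. *)
Lemma ln_fourth_power_le (Phi c : R) n : (0 < n)%N -> 1 <= Phi -> 0 <= c ->
  (ln Phi / n%:R) ^+ 4 <= 8 * c ^+ 4 + 192 * (expR (- (c * n%:R)) * Phi).
Proof.
move=> n0 Phi1 c0; set K := ln Phi.
have nR1 : (1 : R) <= n%:R by rewrite ler1n.
have nR0 : (0 : R) < n%:R by rewrite ltr0n.
have K0 : 0 <= K by exact: ln_ge0.
have Phi0 : 0 < Phi by exact: lt_le_trans Phi1.
have PhiE : expR K = Phi by rewrite lnK.
have tail0 : 0 <= 192 * (expR (- (c * n%:R)) * Phi).
  by rewrite mulr_ge0// mulr_ge0 ?expR_ge0// ltW.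
have [Kc|cK] := lerP (K / n%:R) c.
  apply: (@le_trans _ _ (c ^+ 4)).
    by apply: lerXn2r => //; rewrite nnegrE// divr_ge0// ltW.
  by rewrite ler_wpDr// ler_peMl ?exprn_ge0// ler1n.
set x := K / n%:R - c; have x0 : 0 <= x by rewrite subr_ge0 ltW.
have -> : K / n%:R = x + c by rewrite subrK.
have x4 : x ^+ 4 <= 24 * (expR (- (c * n%:R)) * Phi).
  have -> : expR (- (c * n%:R)) * Phi = expR (x * n%:R).
    by rewrite -PhiE -expRD; congr expR; rewrite mulrBl divfK ?gt_eqF// addrC.
  apply: (@le_trans _ _ (24 * expR x)); last first.
    by rewrite ler_wpM2l// ler_expR ler_peMr.
  have := @expR_ge1Dxn R x 3 x0; rewrite (_ : 4`! = 24)%N//; lra.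
have sq (y z : R) : (y + z) ^+ 2 <= 2 * y ^+ 2 + 2 * z ^+ 2.
  have := sqr_ge0 (y - z); nra.
apply: (@le_trans _ _ (8 * c ^+ 4 + 8 * x ^+ 4)); last by rewrite lerD2l; lra.
rewrite -[4%N]/(2 * 2)%N !exprM.
apply: (@le_trans _ _ ((2 * x ^+ 2 + 2 * c ^+ 2) ^+ 2)).
  by apply: lerXn2r; rewrite ?nnegrE ?sqr_ge0// addr_ge0// mulr_ge0// sqr_ge0.
have := sq (2 * x ^+ 2) (2 * c ^+ 2); lra.
Qed.

End OperatorNormByExponentialSum.

(** * Expectations of products *)

Section ChangeOfLaw.
Local Open Scope ereal_scope.
Context d (T : measurableType d) (R : realType).
Variables (mu : {measure set T -> \bar R}).
Variables (nu : {measure set (measurableTypeR R) -> \bar R}).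
Variables (V : T -> measurableTypeR R) (H : T -> R) (c : R).
Hypothesis mV : measurable_fun setT V.
Hypothesis mH : measurable_fun setT H.
Hypothesis H_ge0 : forall x, (0 <= H x)%R.
Hypothesis indic_eq : forall A, measurable A ->
  \int[mu]_x (\1_A (V x) * H x)%:E = nu A * c%:E.

Import HBNNSimple.

Lemma integral_comp_weighted_nnsfun (h : {nnsfun (measurableTypeR R) >-> R}) :
  \int[mu]_x ((h (V x))%:E * (H x)%:E) = (\int[nu]_y (h y)%:E) * c%:E.
Proof.
under eq_integral.
  move=> x _; rewrite fimfunE -fsumEFin// ge0_mule_fsuml; last first.
    by move=> r; rewrite EFinM nnfun_muleindic_ge0.
  over.
have mI (r : R) : measurable_fun setT (fun x => \1_(h @^-1` [set r]) (V x) : R).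
  by apply: measurableT_comp mV; apply: measurable_indic; exact: measurable_sfunP.
rewrite ge0_integral_fsum//; last 2 first.
  - move=> r; apply: emeasurable_funM; apply/measurable_EFinP => //.
    exact: measurable_funM.
  - by move=> r x _; rewrite mule_ge0 ?lee_fin// -lee_fin EFinM nnfun_muleindic_ge0.
rewrite integralT_nnsfun sintegralE ge0_mule_fsuml; last first.
  by move=> r; exact: nnsfun_mulemu_ge0.
apply: eq_fsbigr => r; rewrite inE => -[y _ hr].
under eq_integral do rewrite -EFinM -mulrA EFinM.
rewrite ge0_integralZl//; last 3 first.
  - by apply/measurable_EFinP/measurable_funM => //; exact: mI.
  - by move=> x _; rewrite lee_fin mulr_ge0.
  - by rewrite lee_fin -hr.
by rewrite indic_eq// muleA.
Qed.

(** Serves twice: with [V] the identity and [H] a density it integrates against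
    the law with that density; with [H] the product of the other factors it turns
    a product rule for events into one for functions. *)
Lemma ge0_integral_comp_weighted (g : measurableTypeR R -> \bar R) :
  measurable_fun setT g -> (forall y, 0 <= g y) ->
  \int[mu]_x (g (V x) * (H x)%:E) = (\int[nu]_y g y) * c%:E.
Proof.
move=> mg g0; pose g_ := nnsfun_approx measurableT mg.
have g_cvg y : EFin \o g_^~ y @ \oo --> g y by apply: cvg_nnsfun_approx.
have g_nd y : {homo (fun n => (g_ n y)%:E) : m n / (m <= n)%N >-> m <= n}.
  by move=> m n mn; rewrite lee_fin; exact/lefP/nd_nnsfun_approx.
transitivity (limn (fun n => \int[mu]_x ((g_ n (V x))%:E * (H x)%:E))).
  rewrite -monotone_convergence//.
  - apply: eq_integral => x _; apply/esym/cvg_lim => //.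
    by apply: cvgeZr => //; exact: g_cvg.
  - move=> n; apply/measurable_EFinP/measurable_funM => //.
    exact: measurableT_comp mV.
  - by move=> n x _; rewrite lee_fin mulr_ge0.
  - by move=> x _ m n mn; rewrite lee_wpmul2r ?lee_fin// -lee_fin g_nd.
have -> : \int[nu]_y g y = limn (fun n => \int[nu]_y (g_ n y)%:E).
  rewrite -monotone_convergence//.
  - by apply: eq_integral => x _; apply/esym/cvg_lim => //; exact: g_cvg.
  - by move=> n; exact/measurable_EFinP.
  - by move=> n x _; rewrite lee_fin.
rewrite -limeMr//.
  by congr (limn _); apply/funext => n; exact: integral_comp_weighted_nnsfun.
apply/ereal_nondecreasing_is_cvgn => a b ab; apply: ge0_le_integral => //.
- by move=> x _; rewrite lee_fin.
- exact/measurable_EFinP.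
- exact/measurable_EFinP.
- by move=> x _; exact: g_nd.
Qed.

End ChangeOfLaw.

Section NormalMoments.
Variable R : realType.

Lemma integral_normal_prob (sigma : R) (g : R -> R) :
  measurable_fun setT g -> (forall y, 0 <= g y) ->
  (\int[normal_prob 0 sigma]_y (g y)%:E =
   \int[lebesgue_measure]_y (g y * normal_pdf 0 sigma y)%:E)%E.
Proof.
move=> mg g0; rewrite -[LHS]mule1.
rewrite -(@ge0_integral_comp_weighted _ _ _ lebesgue_measure _ id
  (normal_pdf 0 sigma) 1) //.
- exact: measurable_normal_pdf.
- by move=> x; exact: normal_pdf_ge0.
- move=> A mA; rewrite mule1 /normal_prob [RHS]integral_mkcond.
  apply: eq_integral => x _; rewrite patchE indicE.
  by case: ifPn => _; rewrite ?mul1r ?mul0r.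
- exact/measurable_EFinP.
Qed.

(** Completing the square: $e^{t x}$ times the density centred at $0$ is a
    multiple of the density centred at $t \sigma^2$. *)
Lemma normal_mgf (sigma t : R) : sigma != 0 ->
  (\int[normal_prob 0 sigma]_y (expR (t * y))%:E =
   (expR (sigma ^+ 2 * t ^+ 2 / 2))%:E)%E.
Proof.
move=> s0; rewrite integral_normal_prob; last 2 first.
- by apply: measurableT_comp => //; exact: measurable_funM.
- by move=> y; exact: expR_ge0.
under eq_integral => y _.
  have -> : expR (t * y) * normal_pdf 0 sigma y =
      expR (sigma ^+ 2 * t ^+ 2 / 2) * normal_pdf (t * sigma ^+ 2) sigma y.
    rewrite !normal_pdfE// /normal_fun mulrCA [RHS]mulrCA -!expRD.
    by congr (_ * expR _); field.
  rewrite EFinM; over.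
rewrite ge0_integralZl//; last 2 first.
- by apply/measurable_EFinP; exact: measurable_normal_pdf.
- by move=> y _; rewrite lee_fin normal_pdf_ge0.
by rewrite integral_normal_pdf mule1.
Qed.

End NormalMoments.

Section ProductRule.
Local Open Scope ereal_scope.
Context d (T : measurableType d) (R : realType) (P : probability T R).
Variables (mu : probability (measurableTypeR R) R) (I : finType).
Variable V : I -> T -> measurableTypeR R.
Hypothesis mV : forall i, measurable_fun setT (V i).
Hypothesis product_rule : forall A : I -> set (measurableTypeR R),
  (forall i, measurable (A i)) ->
  P [set w | forall i, A i (V i w)] = \prod_i mu (A i).
Variables (g : I -> measurableTypeR R -> R) (m : I -> R).
Hypothesis mg : forall i, measurable_fun setT (g i).
Hypothesis g_ge0 : forall i y, (0 <= g i y)%R.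
Hypothesis gE : forall i, \int[mu]_y (g i y)%:E = (m i)%:E.

(** The product rule for events is the case in which every factor is an
    indicator; the factors indexed by [s] are replaced by [g] one at a time. *)
Lemma expectation_mixed_prod (s : seq I) (A : I -> set (measurableTypeR R)) :
  uniq s -> (forall i, measurable (A i)) ->
  \int[P]_w (\prod_i (if i \in s then g i (V i w) else \1_(A i) (V i w)))%:E =
  (\prod_i (if i \in s then m i else fine (mu (A i))))%:E.
Proof.
elim: s A => [|i s IH] A /=.
  move=> _ mA; transitivity (\int[P]_w (\1_[set w | forall i, A i (V i w)] w)%:E).
    apply: eq_integral => w _; congr EFin; rewrite indicE.
    have [wA|/negP wA] := boolP (w \in _).
      by rewrite big1// => i _; rewrite indicE mem_set//; move: wA; rewrite inE.
    have [i Ai] : exists i, ~ A i (V i w).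
      by apply/existsNP => wA'; apply: wA; rewrite inE.
    by rewrite (bigD1 i)//= indicE memNset// mul0r.
  rewrite integral_indic ?setIT//.
    transitivity (\prod_i mu (A i)); first exact: product_rule.
    rewrite -prodEFin.
    by apply: eq_bigr => i _; rewrite fineK// fin_num_measure.
  rewrite (_ : [set w | _] = \bigcap_(i in setT) (V i @^-1` A i)); last first.
    by apply/seteqP; split => w /= wA i; [move=> _|]; apply: wA.
  apply: fin_bigcap_measurable => // i _; rewrite -[X in measurable X]setTI.
  exact: mV.
move=> /andP[si us] mA.
have mfac (B : set (measurableTypeR R)) j : measurable B ->
    measurable_fun setT (fun w => if j \in s then g j (V j w) else \1_B (V j w) : R).
  move=> mB; case: (j \in s); first exact: (measurableT_comp (mg j)).
  by apply: measurableT_comp (mV j); exact: measurable_indic.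
pose H w : R := (\prod_(j | j != i)
  if j \in s then g j (V j w) else \1_(A j) (V j w))%R.
pose c : R := (\prod_(j | j != i) if j \in s then m j else fine (mu (A j)))%R.
transitivity (\int[P]_w ((g i (V i w))%:E * (H w)%:E)).
  apply: eq_integral => w _; rewrite -EFinM (bigD1 i)//= mem_head; congr (_ * _)%:E.
  by apply: eq_bigr => j ji; rewrite inE (negbTE ji).
rewrite (@ge0_integral_comp_weighted _ _ _ P mu (V i) H c _ _ _ _
  (fun y => (g i y)%:E))//.
- rewrite gE -EFinM (bigD1 i)//= mem_head; congr (_ * _)%:E.
  by apply: eq_bigr => j ji; rewrite inE (negbTE ji).
- rewrite /H; under eq_fun do rewrite -big_filter.
  by apply: measurable_prod => j _; exact: mfac.
- by move=> w; apply: prodr_ge0 => j _; case: ifP.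
- move=> B mB; pose A' j := if j == i then B else A j.
  have mA' j : measurable (A' j) by rewrite /A'; case: ifP.
  transitivity (fine (mu B) * c)%:E; last by rewrite EFinM fineK// fin_num_measure.
  transitivity (\int[P]_w (\prod_j (if j \in s then g j (V j w)
                                    else \1_(A' j) (V j w)))%:E).
    apply: eq_integral => w _; rewrite [in RHS](bigD1 i)//= (negbTE si) /A' eqxx.
    congr (_ * _)%:E; apply: eq_bigr => j ji.
    by rewrite (negbTE ji).
  rewrite IH// (bigD1 i)//= (negbTE si) /A' eqxx.
  by congr (_ * _)%:E; apply: eq_bigr => j ji; rewrite (negbTE ji).
- exact/measurable_EFinP.
- by move=> y; rewrite lee_fin.
Qed.

Lemma expectation_prod_of_product_rule :
  \int[P]_w (\prod_i g i (V i w))%:E = (\prod_i m i)%:E.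
Proof.
have := @expectation_mixed_prod (enum I) (fun=> setT) (enum_uniq _) (fun=> measurableT).
under eq_integral do under eq_bigr do rewrite mem_enum inE.
by under eq_bigr do rewrite mem_enum inE.
Qed.

End ProductRule.

(** * Gaussian noise matrices *)

Section RandomMatrixEntries.
Context d (T : measurableType d) (R : realType).

Lemma borel_matrix_continuous_measurable m n (h : 'M[R]_(m, n) -> R) :
  continuous h -> measurable_fun [set: borel 'M[R]_(m, n)] h.
Proof.
move=> /continuousP ch; apply: (measurability _ (RGenOpens.measurableE R)).
move=> _ [_ [a [b ->] <-]]; rewrite setTI.
by apply: sub_sigma_algebra; exact/ch/interval_open.
Qed.

Lemma random_matrix_continuous m n (W : T -> 'M[R]_(m, n)) (h : 'M[R]_(m, n) -> R) :
  random_matrix W -> continuous h -> measurable_fun setT (fun w => h (W w)).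
Proof.
move=> mW ch.
exact: (measurableT_comp (borel_matrix_continuous_measurable ch) mW).
Qed.

Lemma random_matrix_entry m n (W : T -> 'M[R]_(m, n)) i j :
  random_matrix W -> measurable_fun setT (fun w => W w i j).
Proof.
move=> mW; apply: (@random_matrix_continuous _ _ W (fun A => A i j)) => //.
exact: coord_continuous.
Qed.

Lemma row_continuous m n (i : 'I_m) : continuous (fun A : 'M[R]_(m, n) => row i A).
Proof.
move=> A s /= /(nbhs_ballP (row i A)) [e e0 es].
apply/nbhs_ballP; exists e => //= B [_ AB]; apply: es; split => // k j.
by rewrite !mxE.
Qed.

Definition measurable_entries m n (W : T -> 'M[R]_(m, n)) : Prop :=
  forall i j, measurable_fun setT (fun w => W w i j).

Lemma measurable_entries_mul m n k (W : T -> 'M[R]_(m, n)) (W' : T -> 'M[R]_(n, k)) :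
  measurable_entries W -> measurable_entries W' ->
  measurable_entries (fun w => W w *m W' w).
Proof.
move=> mW mW' i j; under eq_fun do rewrite mxE.
by apply: measurable_sum => l; exact: measurable_funM.
Qed.

Lemma measurable_entriesB m n (W W' : T -> 'M[R]_(m, n)) :
  measurable_entries W -> measurable_entries W' ->
  measurable_entries (fun w => W w - W' w).
Proof. by move=> mW mW' i j; under eq_fun do rewrite !mxE; exact: measurable_funB. Qed.

Lemma measurable_frob2 m n (W : T -> 'M[R]_(m, n)) :
  measurable_entries W -> measurable_fun setT (fun w => frob2 (W w)).
Proof.
move=> mW; apply: measurable_sum => i; apply: measurable_sum => j.
exact: measurable_funX.
Qed.

End RandomMatrixEntries.

Section GaussianNoise.
Context d (T : measurableType d) (R : realType) (P : probability T R).
Variables (n p : nat) (sigma : R) (Z : T -> 'M[R]_(n, p)).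
Hypothesis sigma_gt0 : 0 < sigma.
Hypothesis mZ : random_matrix Z.
Hypothesis indep : independent_rows P Z.
Hypothesis normal_rows : forall i,
  has_product_law P (fun w => row i (Z w)) (normal_prob 0 sigma).

(** The rows are independent of one another and each has a product law, so that
    all the entries together satisfy the product rule. *)
Lemma noise_entries_product_rule (A : 'I_n * 'I_p -> set (measurableTypeR R)) :
  (forall ij, measurable (A ij)) ->
  (P [set w | forall ij, A ij (Z w ij.1 ij.2)] =
   \prod_ij normal_prob 0 sigma (A ij))%E.
Proof.
move=> mA; transitivity (\prod_i \prod_j normal_prob 0 sigma (A (i, j)))%E; last first.
  by rewrite pair_bigA; apply: eq_bigr => -[].
pose B i := [set v : borel 'rV[R]_p | forall j, A (i, j) (v 0 j)].
have mB i : measurable (B i).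
  rewrite (_ : B i =
      \bigcap_(j in setT) ((fun v : borel 'rV[R]_p => v 0 j) @^-1` A (i, j))).
    apply: fin_bigcap_measurable => // j _; rewrite -[X in measurable X]setTI.
    have cj : continuous (fun v : 'rV[R]_p => v 0 j) by exact: coord_continuous.
    apply: (borel_matrix_continuous_measurable cj); first exact: measurableT.
    exact: mA.
  by apply/seteqP; split => v /= vA j; [move=> _|]; apply: vA.
transitivity (P [set w | forall i, B i (row i (Z w))]).
  congr (P _); apply/seteqP; split => w /= wA.
    by move=> i j; rewrite mxE; exact: (wA (i, j)).
  by move=> [i j]; have := wA i j; rewrite mxE.
rewrite indep//; apply: eq_bigr => i _.
by rewrite -(normal_rows i) // => j; exact: mA.
Qed.

Lemma expectation_expR_linear (t : 'I_n -> 'I_p -> R) :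
  (\int[P]_w (expR (\sum_i \sum_j t i j * Z w i j))%:E =
   (expR (\sum_i \sum_j sigma ^+ 2 * t i j ^+ 2 / 2))%:E)%E.
Proof.
have /= := @expectation_prod_of_product_rule _ T R P (normal_prob 0 sigma)
  ('I_n * 'I_p)%type (fun ij w => Z w ij.1 ij.2) _ noise_entries_product_rule
  (fun ij y => expR (t ij.1 ij.2 * y))
  (fun ij => expR (sigma ^+ 2 * t ij.1 ij.2 ^+ 2 / 2)).
under eq_integral do rewrite -expR_sum -(pair_bigA _ (fun i j => t i j * Z _ i j)).
rewrite -expR_sum -(pair_bigA _ (fun i j => sigma ^+ 2 * t i j ^+ 2 / 2)).
apply.
- by move=> ij; exact: random_matrix_entry.
- by move=> ij; apply: measurableT_comp => //; exact: measurable_funM.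
- by move=> ij y; exact: expR_ge0.
- by move=> ij; rewrite normal_mgf ?gt_eqF.
Qed.

Lemma measurable_lattice_exp_term lambda (u : 'I_n -> R) (v : 'I_p -> R) :
  measurable_fun setT (fun w => expR (lambda * bilinear (Z w) u v)).
Proof.
apply: measurableT_comp => //; apply: measurable_funM => //.
apply: measurable_sum => i; apply: measurable_sum => j.
by apply: measurable_funM => //; exact: random_matrix_entry.
Qed.

Lemma measurable_lattice_exp_sum lambda :
  measurable_fun setT (fun w => lattice_exp_sum lambda (Z w)).
Proof.
rewrite /lattice_exp_sum; under eq_fun do rewrite -big_filter.
apply: measurable_sum => l; under eq_fun do rewrite -big_filter.
by apply: measurable_sum => k; exact: measurable_lattice_exp_term.
Qed.

(** A union bound: each of the at most $64^{n+p}$ exponentials has for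
    expectation the moment generating function of a centred Gaussian variable
    of variance $\sigma^2 \|l\|^2 \|k\|^2 / p \le 16 \sigma^2 n$. *)
Lemma expectation_lattice_exp_sum : (0 < p)%N ->
  (\int[P]_w (lattice_exp_sum (Num.sqrt p%:R)^-1 (Z w))%:E <=
   (64 ^+ (n + p) * expR (8 * sigma ^+ 2 * n%:R))%:E)%E.
Proof.
move=> p0; set lambda := _^-1.
have lambda2 : lambda ^+ 2 * p%:R = 1.
  by rewrite exprVn sqr_sqrtr// mulVf// pnatr_eq0 -lt0n.
pose E l k : T -> \bar R := fun w =>
  (expR (lambda * bilinear (Z w) (lattice_entry R l) (lattice_entry R k)))%:E.
have mE l k : measurable_fun setT (E l k).
  by apply/measurable_EFinP; exact: measurable_lattice_exp_term.
have E0 l k w : (0 <= E l k w)%E by rewrite lee_fin expR_ge0.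
have EE l k : in_lattice_ball l -> in_lattice_ball k ->
    (\int[P]_w E l k w <= (expR (8 * sigma ^+ 2 * n%:R))%:E)%E.
  move=> lball kball.
  have := expectation_expR_linear
    (fun i j => lambda * (lattice_entry R l i * lattice_entry R k j)).
  have -> : (\int[P]_w (expR (\sum_i \sum_j
      lambda * (lattice_entry R l i * lattice_entry R k j) * Z w i j))%:E =
      \int[P]_w E l k w)%E.
    apply: eq_integral => w _; rewrite /E /bilinear mulr_sumr.
    congr (expR _)%:E; apply: eq_bigr => i _; rewrite mulr_sumr.
    by apply: eq_bigr => j _; ring.
  move=> ->; rewrite lee_fin ler_expR.
  have -> : \sum_i \sum_j sigma ^+ 2 *
      (lambda * (lattice_entry R l i * lattice_entry R k j)) ^+ 2 / 2 =
      sigma ^+ 2 * lambda ^+ 2 / 2 * ((\sum_i lattice_entry R l i ^+ 2) *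
       (\sum_j lattice_entry R k j ^+ 2)).
    rewrite mulr_suml mulr_sumr; apply: eq_bigr => i _.
    by rewrite !mulr_sumr; apply: eq_bigr => j _; field.
  have -> : 8 * sigma ^+ 2 * n%:R =
      sigma ^+ 2 * lambda ^+ 2 / 2 * ((4 * n%:R) * (4 * p%:R)).
    transitivity (8 * sigma ^+ 2 * n%:R * (lambda ^+ 2 * p%:R)); last by field.
    by rewrite lambda2 mulr1.
  apply: ler_wpM2l; first by rewrite divr_ge0// mulr_ge0// sqr_ge0.
  apply: ler_pM; rewrite ?lattice_entry_sum//.
    by apply: sumr_ge0 => i _; exact: sqr_ge0.
  by apply: sumr_ge0 => i _; exact: sqr_ge0.
rewrite /lattice_exp_sum.
under eq_integral do rewrite -sumEFin; rewrite /=.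
under eq_integral do under eq_bigr do rewrite -sumEFin.
under eq_integral do rewrite -big_filter.
rewrite ge0_integral_sum//; last 2 first.
- move=> l; under eq_fun do rewrite -big_filter.
  by apply: emeasurable_sum => k; exact: mE.
- by move=> l w _; apply: sume_ge0 => k _; exact: E0.
rewrite big_filter.
apply: (@le_trans _ _ (\sum_(l : lattice_code n | in_lattice_ball l)
  \sum_(k : lattice_code p | in_lattice_ball k)
    (expR (8 * sigma ^+ 2 * n%:R))%:E)%E).
  apply: lee_sum => l lball.
  under eq_integral do rewrite -big_filter.
  rewrite ge0_integral_sum//; last by move=> k; exact: mE.
  rewrite big_filter; apply: lee_sum => k kball; exact: EE.
rewrite !sumEFin lee_fin !sumr_const.
rewrite -(mulr_natl (expR _ *+ _)) -(mulr_natl (expR _)) mulrA.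
rewrite ler_wpM2r ?expR_ge0// exprD.
by rewrite ler_pM// card_lattice_ball.
Qed.

End GaussianNoise.

(** * Bounds on expectations *)

Section MeanBounds.
Local Open Scope ereal_scope.
Context d (T : measurableType d) (R : realType) (P : probability T R).

(** The integral of a nonnegative function is the supremum of the integrals of
    the simple functions below it, whence monotonicity for functions that are
    not known to be measurable. *)
Lemma ge0_integral_mono (f g : T -> \bar R) :
  (forall w, 0 <= f w) -> (forall w, f w <= g w) ->
  \int[P]_w f w <= \int[P]_w g w.
Proof.
move=> f0 fg; have g0 w : 0 <= g w := le_trans (f0 w) (fg w).
rewrite !ge0_integralTE//; apply: le_ereal_sup => _ [h hf <-].
by exists h => // w; exact: le_trans (hf w) (fg w).
Qed.

(** Measurability and nonnegativity are bundled because the integral is additive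
    only under both. *)
Definition mean_le (X : T -> R) (a : R) : Prop :=
  [/\ measurable_fun setT X, forall w, (0 <= X w)%R
    & \int[P]_w (X w)%:E <= a%:E].

Lemma mean_leD X Y a b : mean_le X a -> mean_le Y b ->
  mean_le (fun w => X w + Y w)%R (a + b)%R.
Proof.
move=> [mX X0 Xa] [mY Y0 Yb]; split.
- exact: measurable_funD.
- by move=> w; exact: addr_ge0.
under eq_integral do rewrite EFinD.
rewrite ge0_integralD//; last 4 first.
- by move=> w _; rewrite lee_fin.
- exact/measurable_EFinP.
- by move=> w _; rewrite lee_fin.
- exact/measurable_EFinP.
by rewrite EFinD leeD.
Qed.

Lemma mean_leZ k X a : (0 <= k)%R -> mean_le X a ->
  mean_le (fun w => k * X w)%R (k * a)%R.
Proof.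
move=> k0 [mX X0 Xa]; split.
- exact: measurable_funM.
- by move=> w; exact: mulr_ge0.
under eq_integral do rewrite EFinM.
rewrite ge0_integralZl//; last 2 first.
- exact/measurable_EFinP.
- by move=> w _; rewrite lee_fin.
by rewrite EFinM lee_wpmul2l.
Qed.

Lemma mean_le_cst k : (0 <= k)%R -> mean_le (fun=> k) k.
Proof.
move=> k0; split=> //.
rewrite integral_cst// [X in _ * X](_ : _ = 1) ?mule1//; exact: probability_setT.
Qed.

Lemma mean_le_sum (I : finType) (X : I -> T -> R) a :
  (forall i, mean_le (X i) a) ->
  mean_le (fun w => \sum_i X i w)%R (#|I|%:R * a)%R.
Proof.
move=> Xa; split.
- by apply: measurable_sum => i; have [] := Xa i.
- by move=> w; apply: sumr_ge0 => i _; have [] := Xa i.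
under eq_integral do rewrite -sumEFin.
rewrite ge0_integral_sum//; last 2 first.
- by move=> i; apply/measurable_EFinP; have [] := Xa i.
- by move=> i w _; rewrite lee_fin; have [] := Xa i.
rewrite mulr_natl -sumr_const -sumEFin.
by apply: lee_sum => i _; have [] := Xa i.
Qed.

Lemma integral_le_mean X Y a : mean_le Y a ->
  (forall w, (0 <= X w)%R) -> (forall w, (X w <= Y w)%R) ->
  \int[P]_w (X w)%:E <= a%:E.
Proof.
move=> [_ _ Ya] X0 XY; apply: le_trans Ya; apply: ge0_integral_mono => w.
  by rewrite lee_fin.
by rewrite lee_fin.
Qed.

End MeanBounds.

(** * Pointwise bound on the risk *)

Section PointwiseBound.
Variables (R : realType) (n d p q : nat).
Variables (x : 'M[R]_(n, d)) (f : 'I_q -> 'rV[R]_d -> R) (B : R).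
Variables (U V : 'M[R]_(p, q)).
Hypothesis n_gt0 : (0 < n)%N.
Hypothesis p_gt0 : (0 < p)%N.
Hypothesis q_gt0 : (0 < q)%N.
Hypothesis x_cube : design_in_cube x.
Hypothesis f_le : forall k v, in_cube v -> `|f k v| <= B.
Hypothesis oU : orthonormal_cols U.
Hypothesis oV : orthonormal_cols V.

(** Normalized squared distances between the column spaces of $U$ and $V$,
    seen from the signal and in Frobenius norm.  Being polynomial in the entries
    they are measurable in $V$; one is added to $B^2$ so as to divide by it. *)
Definition signal_deficit : R :=
  (frob2 (design_values x f) - frob2 (design_values x f *m (U^T *m V))) /
  (n%:R * q%:R * (B ^+ 2 + 1)).

Definition subspace_deficit : R := (q%:R - frob2 (U^T *m V)) / q%:R.

Let nR0 : (0 : R) < n%:R. Proof. by rewrite ltr0n. Qed.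
Let pR0 : (0 : R) < p%:R. Proof. by rewrite ltr0n. Qed.
Let qR0 : (0 : R) < q%:R. Proof. by rewrite ltr0n. Qed.
Let B20 : 0 < B ^+ 2 + 1. Proof. by rewrite ltr_wpDl ?sqr_ge0. Qed.
Let tau2 : R := spectral_norm (sinTheta V U) ^+ 2.
Let tau20 : 0 <= tau2. Proof. exact: sqr_ge0. Qed.

Lemma frob2_design_values_le : frob2 (design_values x f) <= n%:R * q%:R * B ^+ 2.
Proof.
apply: (@le_trans _ _ (\sum_(i < n) \sum_(k < q) B ^+ 2)).
  apply: ler_sum => i _; apply: ler_sum => k _; rewrite mxE.
  rewrite -real_normK ?num_real// lerXn2r ?nnegrE//.
    exact: le_trans (normr_ge0 (f k (row i x))) (f_le _ (x_cube i)).
  exact: f_le (x_cube i).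
rewrite !sumr_const !card_ord.
by rewrite -(mulr_natl (_ *+ q)) -(mulr_natl (B ^+ 2)) mulrA.
Qed.

Lemma signal_deficit_itv : 0 <= signal_deficit <= tau2.
Proof.
rewrite /signal_deficit; apply/andP; split.
  rewrite divr_ge0 ?mulr_ge0 ?(ltW B20)//.
  by rewrite -(frob2_projection_defect _ oV oU) frob2_ge0.
rewrite ler_pdivrMr ?mulr_gt0//.
apply: le_trans (cosine_deficit_le_sinTheta _ oV oU) _.
rewrite ler_wpM2l// (le_trans frob2_design_values_le)//.
by rewrite ler_wpM2l ?mulr_ge0// lerDl.
Qed.

Lemma subspace_deficit_itv : 0 <= subspace_deficit <= tau2.
Proof.
rewrite /subspace_deficit; apply/andP; split.
  rewrite divr_ge0// -(pmulr_rge0 _ (ltr0n _ 2)).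
  by rewrite -(frob2_projectionB oV oU) frob2_ge0.
rewrite ler_pdivrMr//.
have := cosine_deficit_le_sinTheta 1%:M oV oU.
by rewrite mul1mx frob2_1.
Qed.

(** The oracle term plus measurable terms of order $q p / n$ in expectation: the
    products of a deficit with a constant or with the squared operator norm of
    the noise are split with the weight $p / n$. *)
Lemma risk_le (L : 'M[R]_n) (y z : 'M[R]_(n, p)) g (CL c : R) :
  spectral_norm L <= CL ->
  (forall k, values x (g k) = L *m (y *m col k V)) ->
  y = design_values x f *m U^T + z -> 0 <= c ->
  risk x (regression_fun U f) (regression_fun V g) <=
  2 * \sum_k empnorm2 (L *m (y *m col k U) - values x (f k)) +
  4 * CL ^+ 2 * q%:R *
   ((B ^+ 2 + 1) * (p%:R / n%:R + (p%:R / n%:R)^-1 * signal_deficit ^+ 2) +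
    (p%:R / n%:R * (8 * c ^+ 4 + (192 * expR (- (c * n%:R))) *
                    lattice_exp_sum (Num.sqrt p%:R)^-1 z) +
     (p%:R / n%:R)^-1 * subspace_deficit ^+ 2)).
Proof.
move=> L_le fitted yE c0.
set a := p%:R / n%:R; set Phi := lattice_exp_sum _ _.
have a0 : 0 < a by rewrite divr_gt0.
apply: le_trans (risk_decomposition oU fitted yE) _; rewrite lerD2l.
set E := frob2 _ + frob2 _.
have E0 : 0 <= E by rewrite addr_ge0 ?frob2_ge0.
have L2_le : spectral_norm L ^+ 2 <= CL ^+ 2.
  apply: lerXn2r; rewrite ?nnegrE ?spectral_norm_ge0//.
  exact: le_trans (spectral_norm_ge0 L) L_le.
apply: (@le_trans _ _ (4 * CL ^+ 2 * n%:R^-1 * E)).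
  apply: ler_wpM2r => //; apply: ler_wpM2r; first by rewrite invr_ge0.
  exact: ler_wpM2l.
rewrite -[leLHS]mulrA -[leRHS]mulrA.
apply: ler_wpM2l; first by rewrite mulr_ge0// sqr_ge0.
rewrite ler_pdivrMl//.
set K := ln Phi.
have t1E : frob2 (design_values x f *m U^T *m (V *m V^T - U *m U^T)) =
    n%:R * q%:R * (B ^+ 2 + 1) * signal_deficit.
  rewrite (frob2_projection_defect _ oV oU) /signal_deficit mulrC divfK//.
  by rewrite gt_eqF// !mulr_gt0.
have t2E : frob2 (V *m V^T - U *m U^T) = 2 * q%:R * subspace_deficit.
  rewrite (frob2_projectionB oV oU) /subspace_deficit -mulrA [q%:R * _]mulrC.
  by rewrite divfK// gt_eqF.
have noise : frob2 (z *m (V *m V^T - U *m U^T)) <=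
    n%:R * q%:R * (2 * ((K / n%:R) ^+ 2 * subspace_deficit)).
  apply: le_trans (frob2_mul_lattice z _ n_gt0 p_gt0) _; rewrite t2E -/Phi -/K.
  rewrite le_eqVlt; apply/orP; left; apply/eqP; field.
  by rewrite gt_eqF.
have amgm1 := weighted_am_gm 1 signal_deficit a0.
have amgm2 := weighted_am_gm ((K / n%:R) ^+ 2) subspace_deficit a0.
have tail : (K / n%:R) ^+ 4 <= 8 * c ^+ 4 + 192 * (expR (- (c * n%:R)) * Phi).
  apply: ln_fourth_power_le => //; apply: lattice_exp_sum_ge1.
  by rewrite invr_ge0 sqrtr_ge0.
have [t10 _] := andP signal_deficit_itv.
apply: (@le_trans _ _ (n%:R * q%:R *
   ((B ^+ 2 + 1) * signal_deficit + 2 * ((K / n%:R) ^+ 2 * subspace_deficit)))).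
  by rewrite /E t1E [leRHS]mulrDr [in leRHS]mulrA lerD2l.
rewrite [leRHS]mulrA; apply: ler_wpM2l; first by rewrite mulr_ge0.
apply: lerD.
  rewrite ler_wpM2l ?(ltW B20)//.
  have := mulr_ge0 (ltW a0) t10; rewrite expr1n in amgm1.
  by move: amgm1; rewrite [_ / a]mulrC; nra.
apply: le_trans amgm2 _.
rewrite [_ / a]mulrC lerD2r ler_wpM2l ?(ltW a0)// -exprM.
by rewrite (le_trans tail)// mulrA.
Qed.

End PointwiseBound.

(** * Expected terms of the bound in the regression model *)

Section ModelMeasurability.
Context d (T : measurableType d) (R : realType) (P : probability T R).
Variables (n k p q s : nat) (sigma : R) (U : 'M[R]_(p, q)).
Variables (f : 'I_q -> 'rV[R]_k -> R) (X : T -> 'M[R]_(n, k)).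
Variables (Z Y : T -> 'M[R]_(n, p)).
Hypothesis model : regression_model P s sigma U f X Z Y.

(** The functions $f_k$ are controlled on the cube only, but there they agree
    with continuous functions, and the design stays in the cube. *)
Lemma measurable_design_values :
  measurable_entries (fun w => design_values (X w) f).
Proof.
move=> i l; have [g g_smooth fg] := model_smooth model l.
have cg : continuous g by move: g_smooth; case: (s) => [|s'] //= [].
rewrite [X in measurable_fun _ X](_ : _ = (fun w => g (row i (X w)))); last first.
  by apply/funext => w; rewrite mxE fg//; exact: (model_cube model).
apply: (@random_matrix_continuous _ _ _ _ _ X (fun A => g (row i A))).
  exact: (model_design_measurable model).
by move=> A; apply: continuous_comp; [exact: row_continuous|exact: cg].
Qed.

Lemma model_matrix_equation w :
  Y w = design_values (X w) f *m U^T + Z w.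
Proof.
apply/row_matrixP => i; apply: trmx_inj; rewrite (model_equation model).
by rewrite regression_fun_row !linearD.
Qed.

Lemma measurable_responses : measurable_entries Y.
Proof.
move=> i j; under eq_fun do rewrite model_matrix_equation mxE.
apply: measurable_funD; last exact: random_matrix_entry (model_noise_measurable model).
by apply: measurable_entries_mul => //; exact: measurable_design_values.
Qed.

Lemma measurable_signal_deficit B (V : T -> 'M[R]_(p, q)) : random_matrix V ->
  measurable_fun setT (fun w => signal_deficit (X w) f B U (V w)).
Proof.
move=> mV; apply: measurable_funM => //; apply: measurable_funB.
  by apply: measurable_frob2; exact: measurable_design_values.
apply: measurable_frob2; apply: measurable_entries_mul.
  exact: measurable_design_values.
by apply: measurable_entries_mul => // i j; exact: random_matrix_entry.
Qed.

Lemma measurable_subspace_deficit (V : T -> 'M[R]_(p, q)) : random_matrix V ->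
  measurable_fun setT (fun w => subspace_deficit U (V w)).
Proof.
move=> mV; apply: measurable_funM => //; apply: measurable_funB => //.
by apply: measurable_frob2; apply: measurable_entries_mul => // i j;
  exact: random_matrix_entry.
Qed.

Lemma oracle_mean_le (L : 'M[R]_(n, k) -> 'M[R]_n) (C r : R) :
  random_matrix (fun w => L (X w)) -> attains_rate P L U f X Y C r ->
  mean_le P (fun w =>
      \sum_l empnorm2 (L (X w) *m (Y w *m col l U) - values (X w) (f l)))
    (q%:R * (`|C| * n%:R `^ (- r))).
Proof.
move=> mL rate; rewrite -[q in q%:R]card_ord; apply: mean_le_sum => l; split.
- apply: measurable_funM => //.
  under eq_fun do rewrite enorm_sqr.
  apply: measurable_frob2; apply: measurable_entriesB.
    apply: measurable_entries_mul => [i j|]; first exact: random_matrix_entry.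
    by apply: measurable_entries_mul; [exact: measurable_responses|].
  move=> i j; under eq_fun do rewrite mxE.
  have := measurable_design_values i l.
  by under eq_fun do rewrite mxE.
- by move=> w; rewrite mulr_ge0 ?invr_ge0 ?sqr_ge0.
have := rate l; rewrite unlock => /le_trans; apply.
by rewrite lee_fin ler_wpM2r ?powR_ge0// ler_norm.
Qed.

(** The constant [c] absorbs both the $64^{n+p}$ terms of the sum and their
    common bound $e^{8 \sigma^2 n}$, because $p$ is of order at most $n$. *)
Lemma exp_sum_mean_le (c Cp : R) : 0 < sigma -> (0 < p)%N ->
  p%:R <= Cp * n%:R -> (1 + `|Cp|) * ln 64 + 8 * sigma ^+ 2 <= c ->
  mean_le P (fun w => expR (- (c * n%:R)) *
                      lattice_exp_sum (Num.sqrt p%:R)^-1 (Z w)) 1.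
Proof.
move=> s0 p0 p_le c_ge.
have mZ := model_noise_measurable model.
have mean1 : mean_le P (fun w => lattice_exp_sum (Num.sqrt p%:R)^-1 (Z w))
    (64 ^+ (n + p) * expR (8 * sigma ^+ 2 * n%:R)).
  split.
  - exact: measurable_lattice_exp_sum mZ _.
  - move=> w; apply: (le_trans ler01); apply: lattice_exp_sum_ge1.
    by rewrite invr_ge0 sqrtr_ge0.
  - exact: (expectation_lattice_exp_sum s0 mZ (model_noise_independent model)
              (model_normal model) p0).
have [mX X0 X1] := mean_leZ (expR_ge0 (- (c * n%:R))) mean1.
split => //; apply: le_trans X1 _; rewrite lee_fin.
have -> : (64 : R) ^+ (n + p) = expR ((n + p)%:R * ln 64).
  by rewrite mulrC expRM_natr lnK// posrE.
rewrite -!expRD -[leRHS]expR0 ler_expR natrD.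
have ln64 : 0 <= ln (64 : R) by rewrite ln_ge0// ler1n.
have p_le' : p%:R <= `|Cp| * n%:R.
  by rewrite (le_trans p_le)// ler_wpM2r// ler_norm.
have := ler_wpM2r (ler0n R n) c_ge.
have := ler_wpM2r ln64 p_le'; lra.
Qed.

End ModelMeasurability.

Section DeficitMoments.
Context d (T : measurableType d) (R : realType) (P : probability T R).

(** The sines of the principal angles enter expectations through this lemma alone,
    as an upper bound [tau] that may fail to be measurable. *)
Lemma sqr_mean_le (t tau : T -> R) (a : R) : measurable_fun setT t ->
  (forall w, 0 <= t w <= tau w ^+ 2) ->
  (\int[P]_w (tau w ^+ 4)%:E <= a%:E)%E ->
  mean_le P (fun w => t w ^+ 2) a.
Proof.
move=> mt t_itv tau4; split.
- exact: measurable_funX.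
- by move=> w; exact: sqr_ge0.
apply: le_trans tau4; apply: ge0_integral_mono => w; rewrite lee_fin ?sqr_ge0//.
have /andP[t0 t_le] := t_itv w.
by rewrite -[4%N]/(2 * 2)%N exprM lerXn2r// nnegrE// (le_trans t0).
Qed.

End DeficitMoments.

(** * The risk bound *)

Theorem theorem2p1 (R : realType) (d : nat) (sigma r B CU CL Cr Cp : R)
    (d_gt0 : (0 < d)%N) (sigma_gt0 : 0 < sigma) :
  exists C : R, forall K : R, exists C' : R,
  forall (n p q s : nat)
    (disp : measure_display) (T : measurableType disp) (P : probability T R)
    (U : 'M[R]_(p, q)) (f : 'I_q -> 'rV[R]_d -> R)
    (X : T -> 'M[R]_(n, d)) (Z Y : T -> 'M[R]_(n, p))
    (Uhat : T -> 'M[R]_(p, q))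
    (G : 'I_q -> set ('rV[R]_d -> R)) (pen : 'I_q -> ('rV[R]_d -> R) -> \bar R)
    (L : 'M[R]_(n, d) -> 'M[R]_n)
    (fhat : T -> 'I_q -> 'rV[R]_d -> R),
  (0 < n)%N ->
  regression_model P s sigma U f X Z Y ->
  random_matrix Uhat ->
  (forall w, orthonormal_cols (Uhat w)) ->
  ('E_P[fun w => (spectral_norm (sinTheta (Uhat w) U) ^+ 4)%R]
     <= (CU * (p%:R / n%:R) ^+ 2)%:E)%E ->
  (forall k, smoothness_penalty (pen k)) ->
  (forall w k, is_minimizer (G k) (pen k) (X w) (Y w *m col k (Uhat w))
                 (fhat w k)) ->
  direction_invariant p G pen L ->
  random_matrix (fun w => L (X w)) ->
  (forall x, design_in_cube x -> spectral_norm (L x) <= CL) ->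
  attains_rate P L U f X Y Cr r ->
  p%:R <= Cp * n%:R ->
  (forall k x, in_cube x -> `|f k x| <= B) ->
  let ERn := 'E_P[fun w => risk (X w) (regression_fun U f)
                             (regression_fun (Uhat w) (fhat w))]%E in
  (ERn <= (C * (q%:R * n%:R `^ (- r)
                * Num.max 1 (p%:R * n%:R `^ (- (1 - r)))))%:E)%E /\
  (p%:R <= K * n%:R `^ (1 - r) ->
   (ERn <= (C' * (q%:R * n%:R `^ (- r)))%:E)%E).
Proof.
(* $e^{c n}$ dominates $64^{n+p} e^{8 \sigma^2 n}$ when $p \le C_p n$. *)
pose c := (1 + `|Cp|) * ln 64 + 8 * sigma ^+ 2.
have c0 : 0 <= c.
  apply: addr_ge0; apply: mulr_ge0 => //; last exact: sqr_ge0.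
  by rewrite ln_ge0// ler1n.
pose C1 := (B ^+ 2 + 1) * (1 + `|CU|) + (8 * c ^+ 4 + 192 + `|CU|).
have C10 : 0 <= C1.
  apply: addr_ge0; first by rewrite mulr_ge0// addr_ge0// sqr_ge0.
  by rewrite addr_ge0// addr_ge0// mulr_ge0// exprn_ge0.
pose C := 2 * `|Cr| + 4 * CL ^+ 2 * C1.
have C_ge0 : 0 <= C.
  apply: addr_ge0; first exact: mulr_ge0.
  by rewrite mulr_ge0// mulr_ge0// sqr_ge0.
exists C => K; exists (C * Num.max 1 K).
move=> n p q s disp T P U f X Z Y Uhat G pen L fhat n0 model mUhat oUhat sin4 _
  fhat_min dir_inv mL L_le rate p_le f_le ERn.
have nR0 : (0 : R) < n%:R by rewrite ltr0n.
set M := Num.max 1 (p%:R * _).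
suff ERn_le : (ERn <= (C * (q%:R * n%:R `^ (- r) * M))%:E)%E.
  split=> // p_leK; apply: le_trans ERn_le _; rewrite lee_fin.
  rewrite -[leRHS]mulrA ler_wpM2l// [leRHS]mulrC ler_wpM2l ?mulr_ge0 ?powR_ge0//.
  rewrite /M ge_max le_max lexx /= le_max; apply/orP; right.
  by rewrite powRN ler_pdivrMr// powR_gt0.
have risk_ge0 w :
    0 <= risk (X w) (regression_fun U f) (regression_fun (Uhat w) (fhat w)).
  by rewrite risk_frob2 mulr_ge0 ?invr_ge0 ?frob2_ge0.
have ERnE : ERn = (\int[P]_w (risk (X w) (regression_fun U f)
    (regression_fun (Uhat w) (fhat w)))%:E)%E by rewrite /ERn unlock.
(* For $q = 0$ both functions vanish; otherwise $p \ge q > 0$. *)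
case: (posnP q) => [q_0|q0].
  rewrite ERnE integral0_eq ?lee_fin//.
    by rewrite !mulr_ge0 ?powR_ge0// le_max ler01.
  move=> w _; rewrite risk_frob2 /frob2 big1 ?mulr0// => i _.
  rewrite big1// => j _; rewrite !mxE !big1 ?subrr ?expr0n// => k _;
  by have := ltn_ord k; rewrite {2}q_0.
have p0 : (0 < p)%N := leq_trans q0 (model_dim model).
have pR0 : (0 : R) < p%:R by rewrite ltr0n.
have oU := model_orthonormal model.
set a := p%:R / n%:R in sin4.
have a0 : 0 < a by rewrite divr_gt0.
have fitted w k : values (X w) (fhat w k) = L (X w) *m (Y w *m col k (Uhat w)).
  have [_ L_fit] := dir_inv (X w) (Y w) (Uhat w) k (model_cube model w).
  exact: L_fit (fhat_min w k).
have sin4' : (\int[P]_w (spectral_norm (sinTheta (Uhat w) U) ^+ 4)%:E <=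
    (`|CU| * a ^+ 2)%:E)%E.
  move: sin4; rewrite unlock => /le_trans; apply.
  by rewrite lee_fin ler_wpM2r ?sqr_ge0// ler_norm.
have mean_t1 := sqr_mean_le (measurable_signal_deficit model B mUhat)
  (fun w => signal_deficit_itv n0 q0 (model_cube model w) f_le oU (oUhat w)) sin4'.
have mean_t2 := sqr_mean_le (measurable_subspace_deficit U mUhat)
  (fun w => subspace_deficit_itv q0 oU (oUhat w)) sin4'.
have mean_oracle := oracle_mean_le model mL rate.
have mean_noise := exp_sum_mean_le model sigma_gt0 p0 p_le (lexx c).
have a'0 : 0 <= a^-1 by rewrite invr_ge0 ltW.
have B20 : 0 <= B ^+ 2 + 1 by rewrite addr_ge0 ?sqr_ge0.
have k1 : 0 <= 4 * CL ^+ 2 * q%:R by rewrite mulr_ge0// mulr_ge0// sqr_ge0.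
have k2 : 0 <= 8 * c ^+ 4 by rewrite mulr_ge0// exprn_ge0.
(* The pointwise bound of [risk_le], term by term. *)
have mean_rhs := mean_leD (mean_leZ (ler0n R 2) mean_oracle)
  (mean_leZ k1
    (mean_leD
      (mean_leZ B20
        (mean_leD (mean_le_cst P (ltW a0)) (mean_leZ a'0 mean_t1)))
      (mean_leD
        (mean_leZ (ltW a0)
          (mean_leD (mean_le_cst P k2)
            (mean_leZ (ler0n R 192) mean_noise)))
        (mean_leZ a'0 mean_t2)))).
rewrite ERnE; apply: le_trans (integral_le_mean mean_rhs risk_ge0 _) _.
  move=> w /=; rewrite [192 * _]mulrA.
  apply: (risk_le n0 p0 q0 (model_cube model w) f_le oU (oUhat w)) => //.
    exact: L_le (model_cube model w).
  exact: model_matrix_equation model w.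
rewrite lee_fin.
have M1 : 1 <= M by rewrite le_max lexx.
(* $p / n = n^{-r} p n^{-(1-r)}$ is the second argument of the maximum. *)
have aM : a <= n%:R `^ (- r) * M.
  have -> : a = n%:R `^ (- r) * (p%:R * n%:R `^ (- (1 - r))).
    rewrite mulrCA -powRD; last by apply/implyP => _; rewrite gt_eqF.
    have -> : - r + - (1 - r) = -1 by ring.
    by rewrite powR_inv1 ?ltW.
  by rewrite ler_wpM2l ?powR_ge0// le_max lexx orbT.
have -> : (B ^+ 2 + 1) * (a + a^-1 * (`|CU| * a ^+ 2)) +
    (a * (8 * c ^+ 4 + 192 * 1) + a^-1 * (`|CU| * a ^+ 2)) = a * C1.
  by rewrite /C1; field; rewrite gt_eqF.
set rho := n%:R `^ (- r) in aM *; have rho0 : 0 <= rho by exact: powR_ge0.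
rewrite /C [leRHS]mulrDl; apply: lerD.
  have -> : 2 * (q%:R * (`|Cr| * rho)) = 2 * `|Cr| * (q%:R * rho) by ring.
  by rewrite ler_wpM2l ?mulr_ge0// ler_peMr// mulr_ge0.
have -> : 4 * CL ^+ 2 * q%:R * (a * C1) = 4 * CL ^+ 2 * C1 * (q%:R * a) by ring.
apply: ler_wpM2l; first by rewrite mulr_ge0// mulr_ge0// sqr_ge0.
by rewrite -mulrA ler_wpM2l.
Qed.
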